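(* Let $q\ge3$, let $\alpha$ be defined by $\alpha\log(1+q^{-\epsilon-1})=\log(1+q^{-\epsilon})$, and put $\gamma=2$ if $q=3$ and $\gamma=1+2q^{-1}$ otherwise. Let $0<t<d$. (a) $c_{d,t}\le-\lambda_{\min}(1+q^{-\epsilon})^{\frac{\alpha}{\alpha-1}}$, where $\lambda_{\min}:=\min_r\lambda_r^{d-t-1}$ is the smallest eigenvalue of the matrix $\sum_{s=t+1}^dA_s$. (b) If $t$ is odd or $\epsilon\ge1$, then $c_{d,t}\le\gamma(1+q^{-\epsilon})^{\frac{\alpha}{\alpha-1}}q^{t(d-t-1)+\binom t2+t\epsilon}$. (c) If $t$ is even and $\epsilon\le1$, then $c_{d,t}\le\gamma(1+q^{-\epsilon})^{\frac{\alpha}{\alpha-1}}q^{t(d-t-1)+\binom{t+1}2}$.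
   Context: Work in a finite classical polar space of rank $d$, order $q$ and type $\epsilon$ ($\epsilon=0,\frac12,1,1,\frac32,2$ for $Q^+(2d-1,q)$, $H(2d-1,q)$, $Q(2d,q)$, $W(2d-1,q)$, $H(2d,q)$, $Q^-(2d+1,q)$); generators are the maximal totally isotropic (totally singular) subspaces, of vector space dimension $d$. A $(d,t)$-EKR set is a set of generators pairwise meeting in codimension at most $t$ (i.e. $d-\dim(y_1\cap y_2)\le t$); $c_{d,t}$ is the maximum size of such a set. $A_i$ is the adjacency matrix on generators with $(A_i)_{xy}=1$ iff $d-\dim(x\cap y)=i$; these have common eigenspaces $V_0,\dots,V_d$ on which $A_s$ acts as $P_{r,s}=\sum_{j=\max(r-s,0)}^{\min(d-s,r)}(-1)^{r-j}\genfrac{[}{]}{0pt}{}{d-r}{d-s-j}_q\genfrac{[}{]}{0pt}{}{r}{j}_q q^{\binom{r-j}{2}+\binom{s-r+j}{2}+(s-r+j)\epsilon}$; $\lambda_r^a=\sum_{s=0}^aP_{r,d-s}$. $\binom m2=m(m-1)/2$. *)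

(* Defs.v *)
From HB Require Import structures.
From mathcomp Require Import all_boot all_order all_algebra.
From mathcomp Require Import reals exp.

Set Implicit Arguments.
Unset Strict Implicit.
Unset Printing Implicit Defensive.

Import Order.TTheory GRing.Theory Num.Theory.
Import VectorInternalTheory.
Local Open Scope ring_scope.

HB.instance Definition _ (F : finFieldType) (vT : vectType F) :=
  [Countable of {vspace vT} by <:].
HB.instance Definition _ (F : finFieldType) (vT : vectType F) :=
  [Finite of {vspace vT} by <:].

(* In order: Q^+(2d-1,q), H(2d-1,q), Q(2d,q), W(2d-1,q), H(2d,q), Q^-(2d+1,q).
   In the Hermitian cases q is the size of the field of definition, a square. *)
Variant polar_type :=
  | Hyperbolic | HermitianOdd | Parabolic
  | SymplecticType | HermitianEven | Elliptic.

Definition polar_eps (R : realType) (ty : polar_type) : R :=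
  match ty with
  | Hyperbolic => 0
  | HermitianOdd => 1 / 2
  | Parabolic => 1
  | SymplecticType => 1
  | HermitianEven => 3 / 2
  | Elliptic => 2
  end.

(* Vector space dimension, i.e. one more than the projective dimension. *)
Definition ambient_dim (ty : polar_type) (d : nat) : nat :=
  match ty with
  | Hyperbolic | HermitianOdd | SymplecticType => (2 * d)%N
  | Parabolic | HermitianEven => (2 * d).+1
  | Elliptic => (2 * d).+2
  end.

Section Forms.
Variables (F : finFieldType) (n : nat).
Let V := 'rV[F]_n.

Definition polarization (Q : V -> F) (u v : V) : F := Q (u + v) - Q u - Q v.

Definition quadratic_form (Q : V -> F) : Prop :=
  (forall (a : F) (v : V), Q (a *: v) = a ^+ 2 * Q v) /\
  (forall w : V, linear_for *%R (polarization Q ^~ w)) /\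
  (forall w : V, linear_for *%R (polarization Q w)).

(* In characteristic 2 the polarization of a nonsingular form may have a
   nonzero radical (parabolic case); only singular radical vectors are
   excluded. *)
Definition nonsingular (Q : V -> F) : Prop :=
  forall v : V, Q v = 0 -> (forall w : V, polarization Q v w = 0) -> v = 0.

Variant form_on :=
  | QuadraticForm of V -> F
  | SymplecticForm of {skew_symmetric V}
  | HermitianForm (theta : involutive_rmorphism F)
      of {hermitian_sym V for theta}.

Definition nondegenerate_form (f : form_on) : Prop :=
  match f with
  | QuadraticForm Q => quadratic_form Q /\ nonsingular Q
  | SymplecticForm b => is_psymplectic b
  | HermitianForm theta h => ~ (theta =1 id) /\ is_unitary h
  end.

Definition totally_singular (f : form_on) (U : {vspace V}) : bool :=
  match f with
  | QuadraticForm Q => [forall u : V, (u \in U) ==> (Q u == 0)]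
  | SymplecticForm b => (U <= orthov b U)%VS
  | HermitianForm theta h => (U <= orthov h U)%VS
  end.

Definition witt_index (f : form_on) : nat :=
  \max_(U : {vspace V} | totally_singular f U) \dim U.

Definition is_generator (f : form_on) (U : {vspace V}) : bool :=
  totally_singular f U &&
  [forall W : {vspace V}, totally_singular f W ==> (U <= W)%VS ==> (W == U)].

Definition generator (f : form_on) := {U : {vspace V} | is_generator f U}.

Definition meet_codim (f : form_on) (d : nat) (x y : generator f) : nat :=
  (d - \dim (val x :&: val y)%VS)%N.

Definition is_EKR_set (f : form_on) (d t : nat) (Y : {set generator f}) : bool :=
  [forall x in Y, forall y in Y, (meet_codim d x y <= t)%N].

Definition max_EKR (f : form_on) (d t : nat) : nat :=
  \max_(Y : {set generator f} | is_EKR_set d t Y) #|Y|.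

Definition adjacency (R : realType) (f : form_on) (d i : nat) :
    'M[R]_#|{: generator f}| :=
  \matrix_(x, y) (meet_codim d (enum_val x) (enum_val y) == i)%:R.

End Forms.

(* The dimension together with the Witt index separates the types sharing the
   same kind of form. *)
Definition is_polar_space (F : finFieldType) (ty : polar_type) (d : nat)
    (f : form_on F (ambient_dim ty d)) : Prop :=
  [/\ match ty, f with
      | (Hyperbolic | Parabolic | Elliptic), QuadraticForm _ => True
      | SymplecticType, SymplecticForm _ => True
      | (HermitianOdd | HermitianEven), HermitianForm _ _ => True
      | _, _ => False
      end,
      nondegenerate_form f &
      witt_index f = d].

Section Eigenvalues.
Variable R : realType.

Definition gauss_binom (q : R) (n k : nat) : R :=
  \prod_(1 <= i < k.+1) ((q ^+ (n.+1 - i) - 1) / (q ^+ i - 1)).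

Definition eigenP (d : nat) (q eps : R) (r s : nat) : R :=
  \sum_(r - s <= j < (minn (d - s) r).+1)
    (-1) ^+ (r - j) * gauss_binom q (d - r) (d - s - j) * gauss_binom q r j *
    q `^ ('C(r - j, 2)%:R + 'C(s + j - r, 2)%:R + (s + j - r)%:R * eps).

Definition lambda (d : nat) (q eps : R) (a r : nat) : R :=
  \sum_(0 <= s < a.+1) eigenP d q eps r (d - s).

Definition lambda_min (d t : nat) (q eps : R) : R :=
  \big[Num.min/lambda d q eps (d - t - 1) 0]_(0 <= r < d.+1)
    lambda d q eps (d - t - 1) r.

Definition is_smallest_eigenvalue (n : nat) (M : 'M[R]_n) (a : R) : Prop :=
  eigenvalue M a /\ forall b : R, eigenvalue M b -> a <= b.

Definition gamma_const (q : nat) : R :=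
  if q == 3 then 2 else 1 + 2 * q%:R^-1.

End Eigenvalues.

(* Main.v *)
Require Import Defs.
From HB Require Import structures.
From mathcomp Require Import all_boot all_order all_algebra all_field.
From mathcomp Require Import ring lra zify.
From mathcomp Require Import reals exp hoelder convex.

Set Implicit Arguments.
Unset Strict Implicit.
Unset Printing Implicit Defensive.

Import Order.TTheory GRing.Theory Num.Theory.
Local Open Scope ring_scope.

(** Write [e = q^eps].  The generators form a distance-regular graph under
    [d - dim (x :&: y)]: a hyperplane of a generator lies on [e] further
    generators (counted through the vectors [w + a v] on a hyperbolic line), and
    hyperplanes of [x] are counted as the sections [x :&: p^!].  The resulting
    three-term recurrence is the [q]-difference equation of
      [G_r = \prod_(i < r) (1 - q^i X) * \prod_(i < d - r) (1 + e q^i X)],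
    whose coefficients are the [P_(r,s)]; inverting the matrix [P] yields
    orthogonal idempotents diagonalizing all [A_s].  Hoffman's ratio bound and
    [G_0(1) = \prod_(i < d) (1 + e q^i)] give (a), the remaining product being
    dominated by a geometric series of logarithms with ratio [1 / alpha].
    For [r > 0] the sum defining [lambda_r] telescopes, since [1 - X] divides
    [G_r], to minus the [t]-th coefficient of
      [\prod_(0 < i < r) (1 - q^i X) * \prod_(i < d - r) (1 + e q^i X)],
    which is compared factor by factor with a Gaussian coefficient in (b), (c). *)

(** * Coefficients of finite [q]-products *)

Section QProducts.
Variable R : realFieldType.
Variable q : R.
Implicit Types (c e : R) (n k r : nat).

(** The [q]-Pochhammer symbol $(-cX;q)_n$, as a polynomial in ['X]. *)
Definition qprod c n : {poly R} := \prod_(i < n) (1 + (c * q ^+ i) *: 'X).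

Lemma qprod0 c : qprod c 0 = 1.
Proof. exact: big_ord0. Qed.

Lemma qprodSr c n : qprod c n.+1 = qprod c n * (1 + (c * q ^+ n) *: 'X).
Proof. exact: big_ord_recr. Qed.

Lemma qprodD c n k : qprod c (n + k) = qprod c n * qprod (c * q ^+ n) k.
Proof.
elim: k => [|k IHk]; first by rewrite addn0 qprod0 mulr1.
by rewrite addnS !qprodSr IHk -mulrA exprD (mulrA c).
Qed.

Lemma qprodSl c n : qprod c n.+1 = (1 + c *: 'X) * qprod (c * q) n.
Proof. by rewrite -add1n qprodD qprodSr qprod0 mul1r expr0 mulr1 expr1. Qed.

Lemma horner_qprod c n x : (qprod c n).[x] = \prod_(i < n) (1 + c * q ^+ i * x).
Proof. by rewrite horner_prod; apply: eq_bigr => i _; rewrite !hornerE. Qed.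

Lemma size_linear_factor (a : R) : (size (1 + a *: 'X : {poly R})%R <= 2)%N.
Proof.
apply: (leq_trans (size_polyD _ _)); rewrite size_poly1 geq_max /=.
by apply: (leq_trans (size_scale_leq _ _)); rewrite size_polyX.
Qed.

Lemma size_qprod c n : (size (qprod c n) <= n.+1)%N.
Proof.
elim: n => [|n IHn]; first by rewrite qprod0 size_poly1.
rewrite qprodSr; apply: (leq_trans (size_polyMleq _ _)).
by move: (size_linear_factor (c * q ^+ n)); lia.
Qed.

Lemma qprod_coef0 c n : (qprod c n)`_0 = 1.
Proof.
elim: n => [|n IHn]; first by rewrite qprod0 coef1.
by rewrite qprodSr mulrDr mulr1 -scalerAr coefD coefZ coefMX IHn mulr0 addr0.
Qed.

Lemma coef_comp_scaleX (p : {poly R}) (a : R) k :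
  (p \Po (a *: 'X))`_k = a ^+ k * p`_k.
Proof.
rewrite comp_polyE coef_sum.
under eq_bigr => i _ do rewrite exprZn !coefZ coefXn.
have [ltk|gek] := ltnP k (size p).
  rewrite (bigD1 (Ordinal ltk)) //= eqxx mulr1 big1 ?addr0 1?mulrC // => i nei.
  by rewrite (_ : (k == i) = false) ?mulr0 //; apply/negbTE; rewrite eq_sym.
rewrite nth_default // mulr0 big1 // => i _.
by rewrite (_ : (k == i) = false) ?mulr0 //; have := ltn_ord i; lia.
Qed.

Lemma linear_comp_scaleX (a b : R) :
  (1 + a *: 'X) \Po (b *: 'X) = 1 + (a * b) *: 'X :> {poly R}.
Proof. by rewrite comp_polyD comp_polyZ comp_polyX comp_polyC scalerA. Qed.

Lemma qprod_comp c n : qprod c n \Po (q *: 'X) = qprod (c * q) n.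
Proof.
elim: n => [|n IHn]; first by rewrite !qprod0 comp_polyC.
by rewrite !qprodSr comp_polyM IHn linear_comp_scaleX mulrAC.
Qed.

Lemma coef_scale_qprod c a n k : (qprod (c * a) n)`_k = a ^+ k * (qprod c n)`_k.
Proof.
elim: n k => [|n IHn] k.
  by rewrite !qprod0 coef1; case: k => [|k]; rewrite /= ?mulr0 ?mulr1.
rewrite !qprodSr !mulrDr !mulr1 -!scalerAr !coefD !coefZ !coefMX.
case: k => [|k] /=; rewrite !IHn ?exprS; ring.
Qed.

(** Adding a factor in front or at the end gives [F(qX) (1 + cX) = F(X) (1 + c q^n X)] for the
    product [F]; coefficients of [X^(k+1)] are compared there. *)
Lemma coef_qprodS c n k :
  (q ^+ k.+1 - 1) * (qprod c n)`_k.+1 = c * (q ^+ n - q ^+ k) * (qprod c n)`_k.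
Proof.
have: (qprod c n \Po (q *: 'X)) * (1 + c *: 'X)
      = qprod c n * (1 + (c * q ^+ n) *: 'X).
  by rewrite qprod_comp mulrC -qprodSl qprodSr.
rewrite !mulrDr !mulr1 -!scalerAr => /(congr1 (fun p : {poly R} => p`_k.+1)).
rewrite !coefD !coefZ !coefMX /= !coef_comp_scaleX => h.
apply/eqP; rewrite -subr_eq0.
rewrite [X in X == 0](_ : _ =
  (q ^+ k.+1 * (qprod c n)`_k.+1 + c * (q ^+ k * (qprod c n)`_k)) -
  ((qprod c n)`_k.+1 + c * q ^+ n * (qprod c n)`_k)).
  by rewrite h subrr.
ring.
Qed.

Hypothesis q_gt1 : 1 < q.

Let q_gt0 : 0 < q. Proof. exact: lt_trans ltr01 q_gt1. Qed.

Lemma coef_qprod_ge0 c n k : 0 <= c -> 0 <= (qprod c n)`_k.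
Proof.
move=> c0; elim: n k => [|n IHn] k.
  by rewrite qprod0 coef1; case: eqP.
rewrite qprodSr mulrDr mulr1 -scalerAr coefD coefZ coefMX.
rewrite addr_ge0 // mulr_ge0 //; last by case: k.
by rewrite mulr_ge0 // exprn_ge0 // ltW.
Qed.

Lemma coef_qprod_lead c n : (qprod c n)`_n = c ^+ n * q ^+ 'C(n, 2).
Proof.
elim: n => [|n IHn]; first by rewrite qprod0 coef1 mulr1.
rewrite qprodSr mulrDr mulr1 -scalerAr coefD coefZ coefMX /= IHn.
rewrite nth_default ?size_qprod // add0r binS bin1 exprD exprS; ring.
Qed.

(* The normalization by [\prod (1 - q^-i)] makes the induction exact. *)
Lemma coef_qprod_bound c n k : 0 <= c -> (k <= n)%N ->
  (qprod c n)`_k * \prod_(i < k) (1 - q^-1 ^+ i.+1)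
  <= c ^+ k * q ^+ ('C(k, 2) + k * (n - k)).
Proof.
move=> c0; elim: k => [|k IHk] kn.
  by rewrite big_ord0 mulr1 qprod_coef0 mul0n expr0 mulr1.
rewrite big_ord_recr /=.
have qk : (qprod c n)`_k.+1 * (1 - q^-1 ^+ k.+1) =
    q^-1 ^+ k.+1 * (c * (q ^+ n - q ^+ k) * (qprod c n)`_k).
  rewrite -coef_qprodS exprVn; field; apply/negP => /eqP h.
  by move: (exprn_gt0 k.+1 q_gt0); rewrite h ltxx.
rewrite mulrCA qk.
set P := \prod_(i < k) _.
have P0 : 0 <= P.
  apply: prodr_ge0 => i _; rewrite subr_ge0 exprn_ile1 ?invr_ge0 ?ltW //.
  by rewrite invf_lt1.
have f0 := coef_qprod_ge0 n k c0.
apply: (@le_trans _ _ (q ^+ (n - k.+1) * c * ((qprod c n)`_k * P))).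
  have -> : q ^+ (n - k.+1) = q^-1 ^+ k.+1 * q ^+ n.
    rewrite -{2}(subnKC kn) exprD mulrA -exprMn mulVf ?gt_eqF //.
    by rewrite expr1n mul1r.
  have h1 : 0 <= q^-1 ^+ k.+1 by rewrite exprn_ge0 // invr_ge0 ltW.
  have h2 : q ^+ n - q ^+ k <= q ^+ n by rewrite gerBl exprn_ge0 // ltW.
  rewrite -subr_ge0.
  rewrite [X in 0 <= X](_ : _ =
    q^-1 ^+ k.+1 * (c * (q ^+ k * ((qprod c n)`_k * P)))); last by ring.
  by rewrite !mulr_ge0 ?exprn_ge0 ?invr_ge0 ?(ltW q_gt0).
apply: (@le_trans _ _ (q ^+ (n - k.+1) * c * (c ^+ k * q ^+ ('C(k, 2) + k * (n - k))))).
  by apply: ler_wpM2l; rewrite ?mulr_ge0 ?exprn_ge0 ?(ltW q_gt0) ?IHk 1?ltnW.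
have -> : ('C(k.+1, 2) + k.+1 * (n - k.+1) = (n - k.+1) + ('C(k, 2) + k * (n - k)))%N.
  rewrite binS bin1 (_ : n - k = (n - k.+1).+1)%N; last by lia.
  by rewrite mulSn mulnS; lia.
by rewrite !exprD [c ^+ k.+1]exprS le_eqVlt; apply/orP; left; apply/eqP; ring.
Qed.

(** A finite form of the start $1-x-x^2$ of Euler's pentagonal number series. *)
Lemma gauss_prod_bound (x : R) k : 0 <= x -> x <= 1 -> x ^+ 2 + x <= 1 ->
  1 - x - x ^+ 2 <= \prod_(i < k) (1 - x ^+ i.+1).
Proof.
move=> x0 x1 x2; case: k => [|k].
  by rewrite big_ord0; have := exprn_ge0 2 x0; lra.
(* The extra term closes the induction: after the next factor the surplus is
   [x ^+ k.+4 * (1 - x ^+ k)]. *)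
apply: (@le_trans _ _ (1 - x - x ^+ 2 + x ^+ k.+2)).
  by rewrite lerDl exprn_ge0.
elim: k => [|k IHk]; first by rewrite big_ord1 expr1; lra.
rewrite big_ord_recr /=.
have y0 : 0 <= 1 - x ^+ k.+2 by rewrite subr_ge0 exprn_ile1.
apply: le_trans (ler_wpM2r y0 IHk).
rewrite -subr_ge0 [X in 0 <= X](_ : _ = x ^+ k.+4 * (1 - x ^+ k)).
  by rewrite mulr_ge0 ?exprn_ge0 // subr_ge0 exprn_ile1.
rewrite !exprS; ring.
Qed.

(** Cauchy's majorant relation; being stable under products, it compares products of linear factors
    one factor at a time, whatever the signs. *)
Definition coef_dom (p p' : {poly R}) := forall k, `|p`_k| <= p'`_k.

Lemma coef_domM p p' s s' :
  coef_dom p p' -> coef_dom s s' -> coef_dom (p * s) (p' * s').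
Proof.
move=> hp hs k; rewrite !coefM; apply: le_trans (ler_norm_sum _ _ _) _.
by apply: ler_sum => i _; rewrite normrM ler_pM.
Qed.

Lemma coef_dom_qprod c c' n : `|c| <= c' -> coef_dom (qprod c n) (qprod c' n).
Proof.
move=> cc; elim: n => [|n IHn] k.
  by rewrite !qprod0 coef1; case: eqP; rewrite ?normr1 ?normr0.
rewrite !qprodSr; apply: coef_domM => // {}k.
rewrite !coefD !coefZ !coef1 !coefX; case: k => [|[|k]] /=.
- by rewrite !mulr0 !addr0 normr1.
- rewrite !mulr1 !add0r normrM (ger0_norm (exprn_ge0 _ (ltW q_gt0))).
  by rewrite ler_wpM2r ?exprn_ge0 ?(ltW q_gt0).
- by rewrite !mulr0 !addr0 normr0.
Qed.

End QProducts.

(** * Generating polynomials of the eigenvalues *)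

Section EigenvaluePolynomials.
Variables (R : realType) (q e : R) (d : nat).
Hypothesis q_gt1 : 1 < q.

Let q_gt0 : 0 < q. Proof. exact: lt_trans ltr01 q_gt1. Qed.
Let q_neq0 : q != 0. Proof. by rewrite gt_eqF. Qed.
Let exprB1_neq0 k : q ^+ k.+1 - 1 != 0.
Proof. by rewrite subr_eq0 gt_eqF // exprn_egt1. Qed.

Lemma gauss_binom0 n : gauss_binom q n 0 = 1.
Proof. by rewrite /gauss_binom big_geq. Qed.

Lemma gauss_binomS n k :
  gauss_binom q n k.+1 = gauss_binom q n k * ((q ^+ (n - k) - 1) / (q ^+ k.+1 - 1)).
Proof. by rewrite /gauss_binom big_nat_recr //= subSS. Qed.

(** The [q]-binomial theorem: both sides satisfy the same first-order recurrence in [k], the left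
    one by [coef_qprodS]. *)
Lemma coef_qprod_gauss c n k : (k <= n)%N ->
  (qprod q c n)`_k = c ^+ k * gauss_binom q n k * q ^+ 'C(k, 2).
Proof.
elim: k => [|k IHk] kn; first by rewrite qprod_coef0 gauss_binom0 !mulr1.
apply: (mulfI (exprB1_neq0 k)); rewrite coef_qprodS IHk 1?ltnW // gauss_binomS.
have -> : q ^+ n = q ^+ k * q ^+ (n - k) by rewrite -exprD subnKC // ltnW.
rewrite binS bin1 exprD [c ^+ k.+1]exprS; set u := q ^+ k.+1 - 1.
have u0 : u != 0 := exprB1_neq0 k.
by field.
Qed.

Lemma gauss_binom_fact n k : (k <= n)%N ->
  gauss_binom q n k * (\prod_(i < k) (q ^+ i.+1 - 1) *
    \prod_(i < n - k) (q ^+ i.+1 - 1)) = \prod_(i < n) (q ^+ i.+1 - 1).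
Proof.
elim: k => [|k IHk] kn; first by rewrite gauss_binom0 big_ord0 subn0 !mul1r.
rewrite -IHk 1?ltnW // gauss_binomS (_ : n - k = (n - k.+1).+1)%N; last by lia.
rewrite !big_ord_recr /=; have u0 := exprB1_neq0 k; set u := q ^+ k.+1 - 1 in u0 *.
by field.
Qed.

Lemma gauss_binom_sym n k : (k <= n)%N ->
  gauss_binom q n (n - k) = gauss_binom q n k.
Proof.
move=> kn; have := gauss_binom_fact (leq_subr k n); rewrite subKn //.
rewrite -(gauss_binom_fact kn) [X in _ * X = _]mulrC.
apply: mulIf; rewrite mulf_neq0 //; apply/prodf_neq0 => i _; exact: exprB1_neq0.
Qed.

(* Generating polynomial of the [r]-th row of the eigenvalue matrix. *)
Definition eigen_gen (r : nat) : {poly R} := qprod q (-1) r * qprod q e (d - r).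

Lemma size_eigen_gen r : (r <= d)%N -> (size (eigen_gen r) <= d.+1)%N.
Proof.
move=> rd; rewrite /eigen_gen; apply: (leq_trans (size_polyMleq _ _)).
move: (size_qprod q (-1) r) (size_qprod q e (d - r)).
by move: (size _) (size _) => a b; lia.
Qed.

Lemma eigen_gen_coef0 r : (eigen_gen r)`_0 = 1.
Proof. by rewrite coef0M !qprod_coef0 mulr1. Qed.

(** Coefficient of [X^(s+1)] in [G(qX) (1 - X) (1 + eX) = G(X) (1 - q^r X) (1 + e q^(d-r) X)]. Up to
    the factor [q - 1], the multipliers on the left are the intersection numbers and the one on the
    right is an eigenvalue of the distance-one graph. *)
Lemma eigen_gen_rec r s : (r <= d)%N ->
  (q ^+ s.+1 - 1) * (eigen_gen r)`_s.+1 + (e - 1) * (q ^+ s - 1) * (eigen_gen r)`_s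
    + (if s is s'.+1 then e * (q ^+ d - q ^+ s') * (eigen_gen r)`_s' else 0)
  = (e * q ^+ (d - r) - q ^+ r - e + 1) * (eigen_gen r)`_s.
Proof.
move=> rd; set g := eigen_gen r.
have: (g \Po (q *: 'X)) * (1 + (e - 1) *: 'X - e *: 'X^2)
      = g * (1 + (e * q ^+ (d - r) - q ^+ r) *: 'X - (e * q ^+ d) *: 'X^2).
  have f1 : (1 + (-1) *: 'X) * (1 + e *: 'X)
      = 1 + (e - 1) *: 'X - e *: 'X^2 :> {poly R}.
    by rewrite -!mul_polyC !polyCB ?polyCN ?polyC1; ring.
  have f2 : (1 + (-1 * q ^+ r) *: 'X) * (1 + (e * q ^+ (d - r)) *: 'X)
      = 1 + (e * q ^+ (d - r) - q ^+ r) *: 'X - (e * q ^+ d) *: 'X^2 :> {poly R}.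
    have -> : q ^+ d = q ^+ r * q ^+ (d - r) by rewrite -exprD subnKC.
    by rewrite -!mul_polyC !polyCB !polyCM ?polyCN ?polyC1; ring.
  rewrite -f1 -f2 /g /eigen_gen comp_polyM !qprod_comp.
  rewrite mulrACA [_ * (1 + _)]mulrC -qprodSl [_ * (1 + e *: _)]mulrC -qprodSl.
  by rewrite !qprodSr mulrACA.
have cf (p : {poly R}) (a b : R) k : (p * (1 + a *: 'X - b *: 'X^2))`_k.+1 =
    p`_k.+1 + a * p`_k - (if k is k'.+1 then b * p`_k' else 0).
  rewrite mulrDr mulrN mulrDr mulr1 -!scalerAr !(coefD, coefN, coefZ) coefMX coefMXn.
  by case: k => [|k] //=; rewrite ?mulr0 // subSS subn1.
move/(congr1 (fun p : {poly R} => p`_s.+1)); rewrite !cf !coef_comp_scaleX => h.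
move/eqP: h; rewrite -subr_eq0 => h; apply/eqP; rewrite -subr_eq0.
apply: etrans h; congr (_ == 0).
by case: s => [|s]; rewrite ?coef_comp_scaleX ?expr0 ?exprS; ring.
Qed.

Lemma big_nat_mkcond_sub (F : nat -> R) m n k : (n <= k)%N ->
  \sum_(m <= j < n) F j = \sum_(0 <= j < k | (m <= j < n)%N) F j.
Proof.
move=> nk; rewrite (big_nat_widenl m 0) // (big_nat_widen _ _ _ _ _ nk).
by apply: eq_bigl => j; rewrite andTb andbC.
Qed.

(** The Cauchy product of two [q]-binomial expansions, with the first index written as [r - j];
    terms outside the range of [eigenP] vanish for degree reasons. *)
Lemma eigenP_coef (eps : R) r s : e = q `^ eps -> (r <= d)%N -> (s <= d)%N ->
  eigenP d q eps r s = (eigen_gen r)`_s.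
Proof.
move=> he rd sd.
have -> : (eigen_gen r)`_s = \sum_(0 <= j < r.+1 | (r - s <= j < (minn (d - s) r).+1)%N)
   (qprod q (-1) r)`_(r - j) * (qprod q e (d - r))`_(s + j - r).
  rewrite coefM -(big_mkord predT
    (fun i => (qprod q (-1) r)`_i * (qprod q e (d - r))`_(s - i))).
  rewrite (big_nat_mkcond_sub _ _ (_ : s.+1 <= (r + s).+1)%N); last by lia.
  transitivity (\sum_(0 <= i < r.+1 | (i <= s)%N)
    (qprod q (-1) r)`_i * (qprod q e (d - r))`_(s - i)).
    rewrite (big_cat_nat _ (_ : r.+1 <= (r + s).+1)%N) //=; last by lia.
    rewrite [X in _ + X]big_nat_cond [X in _ + X]big1 ?addr0 //.
    move=> i /andP [hi _]; rewrite nth_default ?mul0r //.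
    by apply: leq_trans (size_qprod _ _ _) _; lia.
  rewrite big_nat_rev /= [LHS]big_mkcond [RHS]big_mkcond /=.
  apply: eq_big_nat => j hj; rewrite add0n subSS.
  case: ifP => h1; case: ifP => h2 //; last by exfalso; lia.
    by congr (_ * _`_ _); lia.
  rewrite [X in _ * X]nth_default ?mulr0 //.
  by apply: leq_trans (size_qprod _ _ _) _; lia.
rewrite /eigenP (big_nat_mkcond_sub _ _ (_ : _ <= r.+1)%N); last by lia.
rewrite big_nat_cond [RHS]big_nat_cond; apply: eq_bigr => j hj.
rewrite !coef_qprod_gauss; [|lia|lia].
(* [eigenP] carries the complementary lower indices, hence the two uses of symmetry. *)
rewrite (_ : d - s - j = (d - r) - (s + j - r))%N; last by lia.
rewrite gauss_binom_sym; last by lia.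
rewrite -[gauss_binom q r j]gauss_binom_sym; last by lia.
rewrite powRD ?q_neq0 ?implybT // powRD ?q_neq0 ?implybT // !powR_mulrn ?(ltW q_gt0) //.
rewrite [_%:R * eps]mulrC powRrM powR_mulrn ?powR_ge0 // -he; ring.
Qed.

Lemma lambda_coef (eps : R) t r : e = q `^ eps -> (t < d)%N -> (r <= d)%N ->
  lambda d q eps (d - t - 1) r = \sum_(t.+1 <= s < d.+1) (eigen_gen r)`_s.
Proof.
move=> he td rd; rewrite /lambda.
rewrite [RHS](_ : _ = \sum_(0 + t.+1 <= s < d.+1) (eigen_gen r)`_s) // big_addn.
rewrite [RHS]big_nat_rev /= (_ : d.+1 - t.+1 = (d - t - 1).+1)%N; last by lia.
apply: eq_big_nat => s hs; rewrite (eigenP_coef he) //; last by lia.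
by congr (_`_ _); lia.
Qed.

Lemma eigen_gen_horner0 r k : (k < r)%N -> (eigen_gen r).[q^-1 ^+ k] = 0.
Proof.
move=> kr; rewrite hornerM horner_qprod (bigD1 (Ordinal kr)) //=.
by rewrite mulN1r mulNr exprVn mulfV ?expf_neq0 // subrr !mul0r.
Qed.

Definition eigen_mx : 'M[R]_d.+1 := \matrix_(r, s) (eigen_gen r)`_s.

Hypothesis e_gt0 : 0 < e.

Lemma eigen_gen_horner_diag r : (r <= d)%N -> (eigen_gen r).[q^-1 ^+ r] != 0.
Proof.
move=> rd; rewrite hornerM !horner_qprod mulf_neq0 //; apply/prodf_neq0 => i _.
  have ir := ltn_ord i.
  rewrite mulN1r mulNr subr_eq0 eq_sym exprVn.
  have -> : q ^+ r = q ^+ i * q ^+ (r - i) by rewrite -exprD subnKC // ltnW.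
  rewrite invfM mulrA mulfV ?expf_neq0 // mul1r.
  rewrite lt_eqF // invf_lt1 ?exprn_gt0 // exprn_egt1 // -lt0n; lia.
rewrite gt_eqF // ltr_pwDl // !mulr_ge0 ?exprn_ge0 ?invr_ge0 ?(ltW q_gt0) //.
exact: ltW.
Qed.

(* Evaluating the rows at [q^-k] makes the matrix triangular. *)
Lemma eigen_mx_unit : eigen_mx \in unitmx.
Proof.
pose W : 'M[R]_d.+1 := \matrix_(s, k) (q^-1 ^+ k) ^+ s.
have EW r k : (eigen_mx *m W) r k = (eigen_gen r).[q^-1 ^+ k].
  rewrite mxE (horner_coef_wide _ (size_eigen_gen (leq_ord r))).
  by apply: eq_bigr => s _; rewrite !mxE.
have : eigen_mx *m W \in unitmx.
  rewrite unitmxE unitfE -det_tr det_trig; last first.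
    apply/is_trig_mxP => i j ij; rewrite mxE EW eigen_gen_horner0 //.
  by apply/prodf_neq0 => i _; rewrite mxE EW eigen_gen_horner_diag // leq_ord.
by rewrite unitmx_mul => /andP [].
Qed.

End EigenvaluePolynomials.

(** * Spectral decomposition and the ratio bound *)

Section Spectrum.
Variables (R : realType) (q e : R) (d m : nat) (dist : 'I_m -> 'I_m -> nat).

(* Intersection numbers of a dual polar graph, read as a matrix: for
   [dist x y = u], the number of neighbours of [x] at distance [s] from [y]. *)
Definition intersection_number (s u : nat) : R :=
  ((s == u.+1)%:R * (e * (q ^+ d - q ^+ u)) +
   (s == u)%:R * ((e - 1) * (q ^+ u - 1)) +
   (s.+1 == u)%:R * (q ^+ u - 1)) / (q - 1).

Hypotheses (q_gt1 : 1 < q) (e_gt0 : 0 < e) (m_gt0 : (0 < m)%N).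
Hypothesis dist_sym : forall x y, dist x y = dist y x.
Hypothesis dist_eq0 : forall x y, (dist x y == 0%N) = (x == y).
Hypothesis dist_le : forall x y, (dist x y <= d)%N.
Hypothesis dist_regular : forall x y (s : nat),
  #|[set z | (dist x z == 1%N) && (dist z y == s)]|%:R =
  intersection_number s (dist x y).

Let q1_neq0 : q - 1 != 0. Proof. by rewrite subr_eq0 gt_eqF. Qed.
Let q_gt0 : 0 < q. Proof. exact: lt_trans ltr01 q_gt1. Qed.

Let A (s : nat) : 'M[R]_m := \matrix_(x, y) (dist x y == s)%:R.
Let Pt : 'M[R]_d.+1 := (eigen_mx q e d)^T.
Let Q : 'M[R]_d.+1 := invmx Pt.
Let T : 'M[R]_d.+1 := \matrix_(s, u) intersection_number s u.
Let theta (r : nat) : R := (e * q ^+ (d - r) - q ^+ r - e + 1) / (q - 1).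

(** The coefficients come from the inverse eigenvalue matrix, so the expansion [A_idem] holds by
    construction; orthogonality and idempotence have to be derived from the intersection numbers. *)
Definition idem (r : 'I_d.+1) : 'M[R]_m := \sum_s Q r s *: A s.

Let Pt_unit : Pt \in unitmx.
Proof. by rewrite unitmx_tr eigen_mx_unit. Qed.

Let sum_pick (F : nat -> R) (n k : nat) :
  \sum_(u < n) (k == u :> nat)%:R * F u = (k < n)%:R * F k.
Proof.
have [kn|nk] := ltnP k n; last first.
  rewrite mul0r big1 // => u _; case: eqP => [h|_]; last by rewrite mul0r.
  by have := ltn_ord u; rewrite -h ltnNge nk.
rewrite (bigD1 (Ordinal kn)) //= eqxx !mul1r big1 ?addr0 // => u hu.
by case: eqP => [h|_]; rewrite ?mul0r //; case/eqP: hu; apply: val_inj.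
Qed.

Let lincomb_mul (C D : 'M[R]_d.+1) (X : 'I_d.+1 -> 'M[R]_m) r :
  \sum_s C r s *: \sum_u D s u *: X u = \sum_u (C *m D) r u *: X u.
Proof.
under eq_bigr => s _ do rewrite scaler_sumr.
rewrite exchange_big /=; apply: eq_bigr => u _.
by rewrite mxE scaler_suml; apply: eq_bigr => s _; rewrite scalerA.
Qed.

Let A_idem (s : nat) : (s <= d)%N ->
  A s = \sum_(r < d.+1) (eigen_gen q e d r)`_s *: idem r.
Proof.
rewrite -ltnS => sd; rewrite (eq_bigr (fun r => Pt (Ordinal sd) r *: idem r)); last first.
  by move=> r _; rewrite !mxE.
rewrite lincomb_mul mulmxV // (bigD1 (Ordinal sd)) //= mxE eqxx scale1r.
by rewrite big1 ?addr0 // => u; rewrite eq_sym mxE => /negbTE ->; rewrite scale0r.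
Qed.

Let A1A (s : nat) : A 1 *m A s = \sum_(u < d.+1) intersection_number s u *: A u.
Proof.
apply/matrixP => x y; rewrite mxE summxE.
under eq_bigr => z _ do rewrite !mxE -natrM mulnb.
under [RHS]eq_bigr => u _ do rewrite !mxE mulrC.
rewrite (sum_pick (intersection_number s)) ltnS dist_le mul1r -dist_regular.
rewrite -sum1_card natr_sum [RHS]big_mkcond /=.
by apply: eq_bigr => z _; rewrite inE; case: ifP.
Qed.

(** [eigen_gen_rec] in matrix form: column [r] of [Pt] is an eigenvector of the intersection matrix
    for [theta r]. *)
Let TPt : T *m Pt = Pt *m diag_mx (\row_r theta r).
Proof.
apply/matrixP => s r; rewrite mul_mx_diag !mxE.
set g := eigen_gen q e d r.
(* This closes the recurrence in the last row [s = d], where it would refer to distance [d.+1]. *)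
have gd : g`_d.+1 = 0 by rewrite nth_default // size_eigen_gen // -ltnS.
transitivity (((\sum_(u < d.+1) (s.+1 == u)%:R * ((q ^+ u - 1) * g`_u)) +
    (\sum_(u < d.+1) (s == u :> nat)%:R * ((e - 1) * (q ^+ u - 1) * g`_u)) +
    (\sum_(u < d.+1) (s == u.+1 :> nat)%:R * (e * (q ^+ d - q ^+ u) * g`_u))) / (q - 1)).
  rewrite -!big_split /= mulr_suml; apply: eq_bigr => u _.
  by rewrite !mxE /intersection_number; field.
rewrite (sum_pick (fun u => (q ^+ u - 1) * g`_u)).
rewrite (sum_pick (fun u => (e - 1) * (q ^+ u - 1) * g`_u)) ltn_ord mul1r.
rewrite [X in X + _ + _](_ : _ = (q ^+ s.+1 - 1) * g`_s.+1); last first.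
  rewrite ltnS; have [_|hs] := ltnP s d; first by rewrite mul1r.
  have -> : val s = d by apply/eqP; rewrite eqn_leq hs -ltnS ltn_ord.
  by rewrite gd !mulr0.
rewrite /theta mulrA [g`_s * _]mulrC -eigen_gen_rec ?leq_ord //.
congr ((_ + _) / _); case: s => -[|s] hs /=.
  by rewrite big1 // => u _; rewrite mul0r.
rewrite (sum_pick (fun u => e * (q ^+ d - q ^+ u) * g`_u)).
by rewrite (ltnW hs) mul1r.
Qed.

(** Conjugating [TPt] by [Pt] makes [Q] diagonalize [T], through which [A 1] acts on the [A s]. *)
Let A1_idem r : A 1 *m idem r = theta r *: idem r.
Proof.
rewrite /idem mulmx_sumr; under eq_bigr => s _ do rewrite -scalemxAr A1A.
rewrite (eq_bigr (fun s => Q r s *: \sum_u T s u *: A u)); last first.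
  by move=> s _; congr (_ *: _); apply: eq_bigr => u _; rewrite mxE.
rewrite lincomb_mul.
have -> : Q *m T = diag_mx (\row_r theta r) *m Q.
  rewrite -[LHS]mulmx1 -(mulmxV Pt_unit) -/Q mulmxA -(mulmxA Q) TPt.
  by rewrite mulmxA mulVmx // mul1mx.
rewrite scaler_sumr; apply: eq_bigr => u _.
by rewrite mul_diag_mx !mxE scalerA.
Qed.

Let trmxA s : (A s)^T = A s.
Proof. by apply/matrixP => x y; rewrite !mxE dist_sym. Qed.

Let trmx_idem r : (idem r)^T = idem r.
Proof.
by rewrite raddf_sum /=; apply: eq_bigr => s _; rewrite linearZ /= trmxA.
Qed.

Let theta_inj r s : (r <= d)%N -> (s <= d)%N -> theta r = theta s -> r = s.
Proof.
wlog rs : r s / (r <= s)%N.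
  move=> H rd sd h; case: (leqP r s) => [/H|/ltnW /H]; first exact.
  by move=> H'; apply/esym/H'.
move=> rd sd /(divIf q1_neq0) h; apply/eqP; rewrite eqn_leq rs /= leqNgt.
apply/negP => lt; move/eqP: h; rewrite gt_eqF // ltrD2r ltrD2r.
apply: ltr_leD; first rewrite ?ltr_pM2l //.
  by rewrite ltr_eXn2l //; lia.
by rewrite lerN2 ler_eXn2l.
Qed.

(** By symmetry [A 1] also acts from the right on [idem r]; inserted between the two factors it
    yields both [theta r] and [theta s], which differ. *)
Let idem_ortho r s : r != s -> idem r *m idem s = 0.
Proof.
move=> rs; have h1 : idem r *m A 1 = theta r *: idem r.
  by rewrite -[LHS]trmxK trmx_mul trmxA trmx_idem A1_idem linearZ /= trmx_idem.
have : theta r *: (idem r *m idem s) = theta s *: (idem r *m idem s).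
  by rewrite scalemxAl -h1 -mulmxA A1_idem -scalemxAr.
move/eqP; rewrite -subr_eq0 -scalerBl scaler_eq0 subr_eq0 => /orP [|/eqP //].
by move/eqP/theta_inj => h; case/eqP: rs; apply/val_inj/h; rewrite -ltnS.
Qed.

Let sum_idem : \sum_r idem r = 1%:M.
Proof.
have -> : 1%:M = A 0 by apply/matrixP => x y; rewrite !mxE dist_eq0.
by rewrite A_idem //; apply: eq_bigr => r _; rewrite eigen_gen_coef0 scale1r.
Qed.

Let idemK r : idem r *m idem r = idem r.
Proof.
rewrite -[RHS]mulmx1 -sum_idem [RHS]mulmx_sumr [RHS](bigD1 r) //= big1 ?addr0 // => s sr.
by rewrite idem_ortho // eq_sym.
Qed.

(** From a pair at distance [s < d] a step to distance [s.+1] exists, because the count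
    [e (q^d - q^s) / (q - 1)] is positive. *)
Let dist_surj s : (s <= d)%N -> exists x y, dist x y = s.
Proof.
elim: s => [|s IHs] sd.
  by exists (Ordinal m_gt0), (Ordinal m_gt0); apply/eqP; rewrite dist_eq0.
have [x [y xy]] := IHs (ltnW sd).
have := dist_regular x y s.+1; rewrite xy /intersection_number eqxx mul1r.
rewrite (_ : (s.+1 == s) = false) 1?(_ : (s.+2 == s) = false) ?mul0r ?addr0; [|lia|lia].
have [->|[z]] := set_0Vmem [set z | (dist x z == 1%N) && (dist z y == s.+1)].
  rewrite cards0 => /esym/eqP; rewrite gt_eqF // divr_gt0 ?subr_gt0 //.
  by rewrite mulr_gt0 // subr_gt0 ltr_eXn2l.
by rewrite inE => /andP [_ /eqP h] _; exists z, y.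
Qed.

(** All distances occur, so the [A s] are linearly independent, and [idem r = 0] would make row [r]
    of the invertible [Q] vanish. *)
Let idem_neq0 r : idem r != 0.
Proof.
apply/eqP => h; have Qr0 s : Q r s = 0.
  have [x [y xy]] := dist_surj (leq_ord s).
  move/matrixP: h => /(_ x y); rewrite summxE.
  under eq_bigr => u _ do rewrite !mxE xy.
  rewrite (bigD1 s) //= eqxx mulr1 big1 ?addr0 ?mxE // => u us.
  by rewrite (_ : (s == u :> nat) = false) ?mulr0 //; apply/negbTE; rewrite eq_sym.
have /matrixP /(_ r r) := mulVmx Pt_unit.
rewrite mxE big1 => [|s _]; last by rewrite -/Q Qr0 mul0r.
by rewrite mxE eqxx => /esym/eqP; rewrite oner_eq0.
Qed.

Variable t : nat.
Let lam (r : nat) : R := \sum_(t.+1 <= s < d.+1) (eigen_gen q e d r)`_s.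
Let M := \sum_(t.+1 <= s < d.+1) A s.

Let M_idem : M = \sum_(r < d.+1) lam r *: idem r.
Proof.
rewrite /M (eq_big_nat _ _ (F2 := fun s => \sum_(r < d.+1) (eigen_gen q e d r)`_s *: idem r)).
  by rewrite exchange_big /=; apply: eq_bigr => r _; rewrite -scaler_suml.
by move=> s hs; rewrite A_idem //; lia.
Qed.

Let M_mul_idem (r : 'I_d.+1) : M *m idem r = lam r *: idem r.
Proof.
rewrite M_idem mulmx_suml (bigD1 r) //= -scalemxAl idemK big1 ?addr0 // => s sr.
by rewrite -scalemxAl idem_ortho // scaler0.
Qed.

Let idem_mul_M (r : 'I_d.+1) : idem r *m M = lam r *: idem r.
Proof.
rewrite M_idem mulmx_sumr (bigD1 r) //= -scalemxAr idemK big1 ?addr0 // => s sr.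
by rewrite -scalemxAr idem_ortho ?scaler0 // eq_sym.
Qed.

Lemma scheme_eigenvalue (r : nat) : (r <= d)%N -> eigenvalue M (lam r).
Proof.
rewrite -ltnS => rd; apply/eigenvalueP.
have : ~~ [forall i, row i (idem (Ordinal rd)) == 0].
  apply: contra (idem_neq0 (Ordinal rd)) => /forallP h.
  by apply/eqP/row_matrixP => i; rewrite row0; apply/eqP.
rewrite negb_forall => /existsP [i hi]; exists (row i (idem (Ordinal rd))) => //.
by rewrite -row_mul idem_mul_M linearZ.
Qed.

Lemma scheme_eigenvalueP (b : R) :
  eigenvalue M b -> exists2 r : nat, (r <= d)%N & b = lam r.
Proof.
case/eigenvalueP => v vM v0.
have : ~~ [forall r, v *m idem r == 0].
  apply: contra v0 => /forallP h; rewrite -[v]mulmx1 -sum_idem mulmx_sumr.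
  by rewrite big1 // => r _; apply/eqP.
rewrite negb_forall => /existsP [r hr]; exists r; first by rewrite -ltnS.
have : b *: (v *m idem r) = lam r *: (v *m idem r).
  by rewrite scalemxAl -vM -mulmxA M_mul_idem -scalemxAr.
move/eqP; rewrite -subr_eq0 -scalerBl scaler_eq0 (negbTE hr) orbF subr_eq0.
by move/eqP.
Qed.

(** The all-ones matrix is the sum of all [A s], hence has coefficient $G_r(1)$ on [idem r]; for
    [r > 0] the factor [1 - X] kills it. *)
Let J_idem : const_mx 1 = (eigen_gen q e d 0).[1] *: idem ord0.
Proof.
have -> : const_mx 1 = \sum_(s < d.+1) A s.
  apply/matrixP => x y; rewrite summxE !mxE.
  under eq_bigr => s _ do rewrite mxE -[_%:R]mulr1.
  by rewrite (sum_pick (fun _ => 1)) ltnS dist_le mulr1.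
under eq_bigr => s _ do rewrite A_idem ?leq_ord //.
rewrite exchange_big /= (eq_bigr (fun r : 'I_d.+1 => (eigen_gen q e d r).[1] *: idem r)).
  rewrite (bigD1 ord0) //= big1 ?addr0 // => r r0.
  have := @eigen_gen_horner0 R q e d q_gt1 r 0.
  by rewrite expr0 => -> ; rewrite ?scale0r // lt0n.
move=> r _; rewrite -scaler_suml; congr (_ *: _).
rewrite (horner_coef_wide _ (size_eigen_gen _ q_gt1 (leq_ord r))).
by apply: eq_bigr => s _; rewrite expr1n mulr1.
Qed.

(** The indicator vector of [Y] gives weights [f (idem r)]: they are nonnegative, add up to [#|Y|],
    average [lam] to 0 as no pair in [Y] has distance above [t], and the weight at 0 is fixed by the
    all-ones matrix. *)
Lemma hoffman_bound (Y : {set 'I_m}) (lmin : R) :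
  {in Y &, forall x y, (dist x y <= t)%N} ->
  (forall r, (r <= d)%N -> lmin <= lam r) ->
  (lam 0 - lmin) * #|Y|%:R ^+ 2 <= - lmin * #|Y|%:R * (eigen_gen q e d 0).[1].
Proof.
move=> hY hmin; pose y : 'rV[R]_m := \row_x (x \in Y)%:R.
pose N := (eigen_gen q e d 0).[1].
pose f (B : 'M[R]_m) : R := (y *m B *m y^T) 0 0.
have fZ a B : f (a *: B) = a * f B by rewrite /f -scalemxAr -scalemxAl mxE.
have fsum (X : 'I_d.+1 -> 'M[R]_m) : f (\sum_r X r) = \sum_r f (X r).
  by rewrite /f mulmx_sumr mulmx_suml summxE.
have fE B : f B = \sum_(x in Y) \sum_(z in Y) B x z.
  rewrite /f mxE exchange_big /= big_mkcond [RHS]big_mkcond /=.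
  apply: eq_bigr => z _; rewrite !mxE.
  case: (z \in Y); last by rewrite mulr0.
  rewrite mulr1 [RHS]big_mkcond /=; apply: eq_bigr => x _; rewrite !mxE.
  by case: (x \in Y); rewrite ?mul1r ?mul0r.
(* For a symmetric idempotent this is the squared norm of the projected vector. *)
have w0 r : 0 <= f (idem r).
  rewrite /f -{1}(idemK r) mulmxA -mulmxA -{2}(trmx_idem r) -trmx_mul mxE.
  by apply: sumr_ge0 => x _; rewrite [X in _ * X]mxE -expr2 sqr_ge0.
have w1 : \sum_r f (idem r) = #|Y|%:R.
  rewrite -fsum sum_idem fE -sum1_card natr_sum; apply: eq_bigr => x xY.
  rewrite (bigD1 x) //= mxE eqxx big1 ?addr0 // => z /andP [_ zx].
  by rewrite mxE eq_sym (negbTE zx).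
have wM : \sum_(r < d.+1) lam r * f (idem r) = 0.
  rewrite (eq_bigr (fun r : 'I_d.+1 => f (lam r *: idem r))) => [|r _]; last by rewrite fZ.
  rewrite -fsum -M_idem fE big1 // => x xY; rewrite big1 // => z zY.
  rewrite /M summxE big_nat big1 // => s hs; rewrite mxE.
  by case: eqP => // h; have := hY x z xY zY; lia.
have wN : N * f (idem ord0) = #|Y|%:R ^+ 2.
  rewrite -fZ -J_idem fE.
  under eq_bigr => x _ do under eq_bigr => z _ do rewrite mxE.
  by rewrite !sumr_const -mulrnA expr2 -natrM.
have N0 : 0 <= N.
  rewrite /N hornerM !horner_qprod big_ord0 mul1r prodr_ge0 // => i _.
  by rewrite addr_ge0 // !mulr_ge0 ?exprn_ge0 ?(ltW q_gt0) ?(ltW e_gt0).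
(* Only [r = 0] keeps its own eigenvalue; every other one is replaced by [lmin]. *)
have : (lam 0 - lmin) * f (idem ord0) + lmin * #|Y|%:R <= 0.
  rewrite -wM -w1 mulr_sumr [X in _ + X](bigD1 ord0) //= [X in _ <= X](bigD1 ord0) //=.
  rewrite mulrBl addrA subrK lerD2l; apply: ler_sum => r _.
  by rewrite ler_wpM2r // hmin // -ltnS.
move=> /(ler_wpM2l N0); rewrite mulr0 mulrDr mulrCA wN -/N => h.
by rewrite -subr_ge0; move: h; rewrite -oppr_ge0 => h; apply: le_trans h _; lra.
Qed.

End Spectrum.

(** * Lower bounds for the eigenvalues *)

Section EigenvalueBounds.
Variables (R : realType) (q e : R) (d t : nat).
Hypotheses (q_gt1 : 1 < q) (e_ge1 : 1 <= e) (t_lt_d : (t < d)%N).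

Let q_gt0 : 0 < q. Proof. exact: lt_trans ltr01 q_gt1. Qed.
Let e_ge0 : 0 <= e. Proof. exact: le_trans ler01 e_ge1. Qed.
Let lam (r : nat) : R := \sum_(t.+1 <= s < d.+1) (eigen_gen q e d r)`_s.

(* The factor [1 - 'X] of the generating polynomial makes the sum telescope. *)
Lemma lambda_telescope r : (r < d)%N ->
  lam r.+1 = - (qprod q (- q) r * qprod q e (d - r.+1))`_t.
Proof.
move=> rd; set H := _ * _.
have -> : lam r.+1 = \sum_(t.+1 <= s < d.+1) ((1 + (-1) *: 'X) * H)`_s.
  by rewrite /lam /eigen_gen qprodSl mulN1r /H mulrA.
rewrite big_add1 /= (eq_bigr (fun s => H`_s.+1 - H`_s)); last first.
  by move=> s _; rewrite mulrDl mul1r -scalerAl scaleN1r coefB coefXM.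
rewrite telescope_sumr ?(ltnW t_lt_d) // [H`_d]nth_default ?sub0r //.
rewrite /H; apply: (leq_trans (size_polyMleq _ _)).
move: (size_qprod q (- q) r) (size_qprod q e (d - r.+1)).
by move: (size _) (size _) => a b; lia.
Qed.

Lemma lambda0_ge : e ^+ d * q ^+ 'C(d, 2) <= lam 0.
Proof.
rewrite /lam big_nat_recr //= /eigen_gen qprod0 mul1r subn0.
by rewrite coef_qprod_lead // lerDr sumr_ge0 // => s _; apply: coef_qprod_ge0.
Qed.

Lemma lambda1E : (0 < d)%N -> lam 1 = - (qprod q e d.-1)`_t.
Proof. by move=> d0; rewrite lambda_telescope // qprod0 mul1r subn1. Qed.

Let q_exp_ge1 k : 1 <= q ^+ k. Proof. by rewrite exprn_ege1 // ltW. Qed.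

(** If [r.+1 < d], a factor [1 + e X] is common to both products and the others are compared using
    [1 <= e] and [1 <= q]. If [r.+1 = d], no such factor is left: then the sign for odd [t] makes
    the coefficient nonpositive, or [q <= e] gives the comparison directly. *)
Lemma lambda_ge_eprod r : (r < d)%N -> [|| r.+1 != d, odd t | q <= e] ->
  - lam r.+1 <= (qprod q e d.-1)`_t.
Proof.
move=> rd hr; rewrite lambda_telescope // opprK.
have dom p p' : coef_dom p p' -> p`_t <= p'`_t.
  by move=> h; apply: le_trans (ler_norm _) (h t).
have [rd1|rd1] := eqVneq r.+1 d.
  rewrite rd1 subnn qprod0 mulr1.
  move: hr; rewrite rd1 eqxx /= => /orP [ot|qe].
    rewrite -[- q]mulrN1 coef_scale_qprod -signr_odd ot expr1 mulN1r.
    apply: (@le_trans _ _ 0); last exact: coef_qprod_ge0.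
    by rewrite oppr_le0 coef_qprod_ge0 // ltW.
  rewrite -rd1 /=; apply/dom/coef_dom_qprod => //.
  by rewrite normrN gtr0_norm.
have -> : (d - r.+1 = (d - r.+2).+1)%N by lia.
have -> : d.-1 = (r + (d - r.+2)).+1 by lia.
rewrite !qprodSl qprodD mulrCA; apply/dom/coef_domM.
  move=> k; rewrite coefD coefZ ger0_norm // addr_ge0 ?mulr_ge0 //.
    by rewrite coef1; case: eqP.
  by rewrite coefX; case: eqP.
apply: coef_domM; apply: coef_dom_qprod => //.
  by rewrite normrN gtr0_norm // ler_peMl // ltW.
by rewrite ger0_norm ?mulr_ge0 ?(ltW q_gt0) // ler_peMr // mulr_ge0 // ltW.
Qed.

(** Both [e] and [- q] are at most [q] in absolute value; the factors with [e] are matched with the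
    first ones of the majorant, those with [- q] with the later, larger ones. *)
Lemma lambda_ge_qprod r : (r < d)%N -> e <= q ->
  - lam r.+1 <= (qprod q q d.-1)`_t.
Proof.
move=> rd eq; rewrite lambda_telescope // opprK.
have -> : d.-1 = ((d - r.+1) + r)%N by lia.
rewrite qprodD mulrC; apply: (le_trans (ler_norm _)).
apply: coef_domM; apply: coef_dom_qprod => //; first by rewrite ger0_norm.
by rewrite normrN gtr0_norm // ler_peMr // ltW.
Qed.

End EigenvalueBounds.

(** [gamma_const] absorbs the Euler product of [coef_qprod_bound]. With [x = 1/q], [(1 + 2x)(1 - x -
    x^2) - 1 = x (1 - 3x - 2x^2)] is nonnegative for [x <= 1/4] but negative at [x = 1/3], so
    [q = 3] has its own constant. *)
Lemma coef_qprod_gamma (R : realType) (q : nat) (c : R) n k :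
  (3 <= q)%N -> 0 <= c -> (k <= n)%N ->
  (qprod q%:R c n)`_k
  <= gamma_const R q * (c ^+ k * q%:R ^+ ('C(k, 2) + k * (n - k))).
Proof.
move=> q3 c0 kn; have q_gt1 : 1 < q%:R :> R by rewrite ltr1n; lia.
have := coef_qprod_bound q_gt1 c0 kn; set P := \prod_(i < k) _; set B := c ^+ k * _.
have f0 := coef_qprod_ge0 q_gt1 n k c0; set f := (_)`_k in f0 * => h.
pose x : R := q%:R^-1.
have x0 : 0 < x by rewrite invr_gt0 (lt_trans ltr01).
have xle (p : nat) : (0 < p)%N -> (p <= q)%N -> x <= p%:R^-1.
  by move=> p0 pq; rewrite lef_pV2 ?posrE ?ler_nat // ltr0n //; lia.
have x3 : x <= 3^-1 by apply: xle.
have xx : x ^+ 2 <= 3^-1 * x by rewrite expr2 ler_wpM2r // ltW.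
have hP : 1 - x - x ^+ 2 <= P by apply: gauss_prod_bound; [exact: ltW|lra|lra].
have gP : 1 <= gamma_const R q * P.
  apply: (@le_trans _ _ (gamma_const R q * (1 - x - x ^+ 2))); last first.
    rewrite ler_wpM2l // /gamma_const; case: ifP => // _.
    by rewrite -/x; lra.
  rewrite /gamma_const; case: ifP => [_|q3']; first by lra.
  have x4 : x <= 4^-1 by apply: xle => //; move/eqP: q3'; lia.
  rewrite -/x -subr_ge0.
  rewrite [X in 0 <= X](_ : _ = x * (1 - 3 * x - 2 * (x * x))); last by ring.
  have : x * x <= 4^-1 * x by rewrite ler_wpM2r // ltW.
  by move=> xx4; apply: mulr_ge0; lra.
apply: (@le_trans _ _ (gamma_const R q * (f * P))).
  by rewrite mulrCA -[X in X <= _]mulr1 ler_wpM2l.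
rewrite ler_wpM2l // /gamma_const; case: ifP => // _.
by rewrite -/x; lra.
Qed.

(** * A product bound through logarithms *)

Section LogBound.
Variables (R : realType) (q x0 alpha : R).
Hypotheses (q_gt1 : 1 < q) (x0_gt0 : 0 < x0).
Hypothesis alpha_def : alpha * ln (1 + x0 / q) = ln (1 + x0).

Let q_gt0 : 0 < q. Proof. exact: lt_trans ltr01 q_gt1. Qed.

Let ln1D_gt0 (x : R) : 0 < x -> 0 < ln (1 + x).
Proof. by move=> x_gt0; rewrite ln_gt0 // ltrDl. Qed.

(* Convexity of a power function: with [p = ln (1 + x0) / ln (1 + x)],
   [(1 + x / q)^p = ((1 - 1/q) + (1 + x)/q)^p <= (1 - 1/q) + (1 + x)^p / q]. *)
Lemma ln1D_ratio (x : R) : 0 < x -> x <= x0 ->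
  ln (1 + x / q) * ln (1 + x0) <= ln (1 + x) * ln (1 + x0 / q).
Proof.
move=> x_gt0 xx0; have lx := ln1D_gt0 x_gt0.
pose p := ln (1 + x0) / ln (1 + x).
have p1 : 1 <= p.
  by rewrite ler_pdivlMr // mul1r ler_ln ?posrE ?addr_gt0 // lerD2l.
have xp : (1 + x) `^ p = 1 + x0.
  by rewrite /powR gt_eqF ?addr_gt0 // /p divfK ?gt_eqF // lnK // posrE addr_gt0.
have q01 : 0 <= q^-1 <= 1 by rewrite invr_ge0 ltW //= invf_le1 // ltW.
have := @convex_powR R p p1 (interval_inference.Itv01 (andP q01).1 (andP q01).2) (1 + x) 1.
rewrite !classical_sets.in_setE /= !in_itv /= !andbT ler01.
rewrite addr_ge0 ?(ltW x_gt0) // => /(_ isT isT).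
rewrite convRE [X in X `^ _ <= _]convRE /= powR1 xp /unstable.onem.
have -> : q^-1 * (1 + x) + (1 - q^-1) * 1 = 1 + x / q by ring.
have -> : q^-1 * (1 + x0) + (1 - q^-1) * 1 = 1 + x0 / q by ring.
have xq : 0 < x / q by rewrite divr_gt0.
have xq0 : 0 < x0 / q by rewrite divr_gt0.
move=> h; have : ln ((1 + x / q) `^ p) <= ln (1 + x0 / q).
  by rewrite ler_ln ?posrE ?powR_gt0 ?addr_gt0.
rewrite ln_powR /p mulrAC ler_pdivrMr // => h2.
by rewrite mulrC (le_trans h2) // mulrC.
Qed.

Let l1_gt0 : 0 < ln (1 + x0 / q).
Proof. by rewrite ln1D_gt0 // divr_gt0. Qed.

Lemma alpha_gt1 : 1 < alpha.
Proof.
rewrite -(ltr_pM2r l1_gt0) alpha_def mul1r ltr_ln ?posrE ?addr_gt0 ?divr_gt0 //.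
by rewrite ltrD2l ltr_pdivrMr // ltr_pMr.
Qed.

Lemma ln1D_geometric k : ln (1 + x0 * q^-1 ^+ k) <= alpha^-1 ^+ k * ln (1 + x0).
Proof.
have a0 : 0 < alpha := lt_trans ltr01 alpha_gt1.
elim: k => [|k IHk]; first by rewrite !expr0 mulr1 mul1r.
set x := x0 * q^-1 ^+ k; have x_gt0 : 0 < x by rewrite mulr_gt0 // exprn_gt0 // invr_gt0.
have xx0 : x <= x0.
  by rewrite ler_piMr ?(ltW x0_gt0) // exprn_ile1 ?invr_ge0 ?(ltW q_gt0) // invf_le1 // ltW.
rewrite exprSr mulrA -/x exprS -mulrA ler_pdivlMl //.
apply: le_trans IHk; rewrite -(ler_pM2r l1_gt0) mulrAC alpha_def mulrC.
exact: ln1D_ratio.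
Qed.

Lemma prod1D_le_powR n :
  \prod_(i < n) (1 + x0 * q^-1 ^+ i) <= (1 + x0) `^ (alpha / (alpha - 1)).
Proof.
have a1 := alpha_gt1; have a0 : 0 < alpha := lt_trans ltr01 a1.
have pos i : 0 < 1 + x0 * q^-1 ^+ i.
  by rewrite addr_gt0 // mulr_gt0 // exprn_gt0 // invr_gt0.
have L0 := ln1D_gt0 x0_gt0.
(* The right side is the full geometric series. *)
have S : \sum_(i < n) alpha^-1 ^+ i <= alpha / (alpha - 1).
  rewrite ler_pdivlMr ?subr_gt0 // mulrC.
  have -> : alpha - 1 = alpha * (1 - alpha^-1) by field; rewrite gt_eqF.
  rewrite -mulrA -opprB mulNr -subrX1 opprB ler_piMr ?(ltW a0) // gerBl.
  by rewrite exprn_ge0 // invr_ge0 ltW.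
rewrite /powR gt_eqF ?addr_gt0 //.
apply: (@le_trans _ _ (sequences.expR (\sum_(i < n) ln (1 + x0 * q^-1 ^+ i)))).
  rewrite expR_sum le_eqVlt; apply/orP; left; apply/eqP.
  by apply: eq_bigr => i _; rewrite lnK // posrE.
rewrite ler_expR; apply: le_trans (ler_wpM2r (ltW L0) S).
by rewrite mulr_suml; apply: ler_sum => i _; apply: ln1D_geometric.
Qed.

End LogBound.

(* [lia] compares atoms syntactically, hence misses dimensions that agree only
   up to conversion of the vector space structures. *)
Ltac dimlia :=
  repeat match goal with
  | H : is_true (leq _ _) |- _ => revert H
  | H : @eq ?T _ _ |- _ => unify T nat; revert H
  end;
  repeat match goal with |- context [dimv ?U] =>
    let a := fresh in set a := (dimv U); clearbody a end;
  lia.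

(** * Counting neighbours of a generator *)

Section PolarGeometry.
Variables (F : finFieldType) (n : nat).
Local Notation V := 'rV[F]_n.
Variables (eps : bool) (theta : {rmorphism F -> F}).
Variable h : {hermitian V for eps & theta}.
Variables (sing : pred V) (d k : nat).
Local Notation q := #|F|.
Local Notation "U ^!" := (orthov h U).
Implicit Types (U W H x y z : {vspace V}) (u v w p : V).

(** One description for all types: [sing] is the vanishing of the quadratic form, always true in the
    symplectic case, and isotropy in the Hermitian case; [h] is the polarization or the form
    itself. *)
Definition tsing U : bool :=
  [forall u : V, (u \in U) ==> sing u] && (U <= U^!)%VS.

Hypothesis sing_lin : forall (a : F) u v,
  sing u -> sing v -> h u v = 0 -> sing (a *: u + v).
Hypothesis sing_isotropic : forall u, sing u -> h u u = 0.
Hypothesis sing_nondeg : forall v, sing v -> (forall w, h w v = 0) -> v = 0.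
(* The number of singular points, other than [<v>], on a hyperbolic line. *)
Hypothesis sing_line : forall v w, sing v -> h w v = 1 ->
  #|[set a : F | sing (w + a *: v)]| = k.
Hypothesis tsing_dim : forall U, tsing U -> (\dim U <= d)%N.
Hypothesis tsing_ex : exists2 U, tsing U & \dim U = d.
Hypothesis d_gt0 : (0 < d)%N.

Definition gen U : bool := tsing U && (\dim U == d).

Lemma tsingP U : reflect ({in U, forall u, sing u} /\ (U <= U^!)%VS) (tsing U).
Proof.
apply: (iffP andP) => -[hU hp]; split=> //.
  by move=> u uU; move/forallP: hU => /(_ u); rewrite uU.
by apply/forallP => u; apply/implyP; apply: hU.
Qed.

Lemma orthovS U W : (U <= W)%VS -> (W^! <= U^!)%VS.
Proof.
move=> UW; apply/subvP => u /mem_orthovP hu; apply/mem_orthovP => w wU.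
exact: hu (subvP UW _ wU).
Qed.

Lemma orthov_add U W : ((U + W)^! = U^! :&: W^!)%VS.
Proof.
by apply/vspaceP => u; rewrite memv_cap !memvE orthovD.
Qed.

Lemma tsing_sub U W : (U <= W)%VS -> tsing W -> tsing U.
Proof.
move=> UW /tsingP [hs hp]; apply/tsingP; split.
  by move=> u /(subvP UW) /hs.
by apply: subv_trans UW (subv_trans hp (orthovS UW)).
Qed.

Lemma tsing_sum U W : tsing U -> tsing W -> (W <= U^!)%VS -> tsing (U + W).
Proof.
move=> /tsingP [sU pU] /tsingP [sW pW] WU; apply/tsingP; split.
  move=> _ /memv_addP [u uU [w wW ->]].
  have := sing_lin 1 (sU u uU) (sW w wW); rewrite scale1r; apply.
  by move/orthovP: WU => /(_ w u wW uU) /eqP; rewrite herm_eq0C => /eqP.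
by rewrite orthov_add subv_cap !subv_add pU pW WU orthov_sym WU.
Qed.

Lemma tsing_line w : sing w -> tsing <[w]>.
Proof.
move=> sw; apply/tsingP; split.
  have s0 : sing 0.
    have := sing_lin (-1) sw sw (sing_isotropic sw).
    by rewrite scaleN1r addNr.
  move=> _ /vlineP [a ->]; have := sing_lin a sw s0.
  by rewrite addr0 linear0r; apply.
by rewrite orthov11 sing_isotropic.
Qed.

Lemma tsing_add_line U w : tsing U -> sing w -> w \in U^! -> tsing (U + <[w]>).
Proof. by move=> tU sw wU; rewrite tsing_sum ?tsing_line // -memvE. Qed.

Lemma dim_cap_orthov_span W (s : seq V) :
  (\dim W <= \dim (W :&: <<s>>^!) + size s)%N.
Proof.
elim: s W => [|u s IHs] W; first by rewrite span_nil orthov0 capvf addn0.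
rewrite span_cons orthov_add capvA /=.
by have := IHs (W :&: <[u]>^!)%VS; have := leq_dim_orthov1 h u W; dimlia.
Qed.

Lemma dim_cap_orthov W U : (\dim W <= \dim (W :&: U^!) + \dim U)%N.
Proof.
have := dim_cap_orthov_span W (vbasis U).
by rewrite (span_basis (vbasisP U)) size_tuple.
Qed.

(** Since [I] is orthogonal to [W], only a complement of [I] in [U] imposes conditions on [W]. *)
Lemma dim_cap_orthov_rel W U I : (I <= U)%VS -> (I <= W^!)%VS ->
  (\dim W + \dim I <= \dim (W :&: U^!) + \dim U)%N.
Proof.
move=> IU IW; have := dim_cap_orthov W (U :\: I)%VS.
have -> : (W :&: (U :\: I)^! = W :&: U^!)%VS.
  rewrite -{2}(addv_diff_cap U I) orthov_add capvA; apply/esym/capv_idPl.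
  apply: subv_trans (capvSl _ _) _; rewrite orthov_sym.
  exact: subv_trans (capvSr _ _) IW.
have := dimv_cap_compl U I; have -> : (U :&: I = I)%VS by apply/capv_idPr.
by dimlia.
Qed.

Let dimV : \dim (fullv : {vspace V}) = n.
Proof. by rewrite dimvf /dim /= mul1n. Qed.

(** Nondegeneracy concerns singular vectors, whence [tsing U]: a vector of [U] orthogonal to a
    complement of [U^!] is orthogonal to everything, thus zero, and this bounds [\dim U] by the
    dimension of that complement. *)
Lemma dim_orthov U : tsing U -> (\dim U^! + \dim U)%N = n.
Proof.
move=> /tsingP [sU pU]; apply/eqP; rewrite eqn_leq; apply/andP; split; last first.
  by have := dim_cap_orthov fullv U; rewrite capfv dimV.
have := dim_cap_orthov U (U^!^C)%VS.
have -> : (U :&: (U^!^C)^! = 0)%VS.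
  apply/eqP; rewrite -subv0; apply/subvP => u; rewrite memv_cap => /andP [uU uC].
  rewrite memv0; apply/eqP/sing_nondeg; first exact: sU.
  move=> w; have : w \in (U^!^C + U^!)%VS by rewrite addvC addv_complf memvf.
  case/memv_addP => w1 w1C [w2 w2U ->]; rewrite linearDl /=.
  rewrite [h w2 u](mem_orthovP w2U) // addr0; apply/eqP; rewrite herm_eq0C.
  by apply/eqP/(mem_orthovP uC).
rewrite dimv0 dimv_compl dimV.
by have := dimvS (subvf U^!); rewrite dimV; dimlia.
Qed.

(** For [W] of dimension [d], [W :&: U^!] has larger dimension than [U :&: W], so it contains a
    vector outside [U]. *)
Lemma tsing_extend U : tsing U -> (\dim U < d)%N ->
  exists2 w, w \notin U & tsing (U + <[w]>).
Proof.
move=> tU dU; have [W tW dW] := tsing_ex.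
have [/tsingP [sU pU] /tsingP [sW pW]] := (tU, tW).
have := @dim_cap_orthov_rel W U (U :&: W)%VS (capvSl _ _).
rewrite orthov_sym => /(_ (subv_trans pW (orthovS (capvSr _ _)))) hd.
have : ~~ (W :&: U^! <= U)%VS.
  apply/negP => hs; have : (W :&: U^! <= U :&: W)%VS by rewrite subv_cap hs capvSl.
  by move=> /dimvS; dimlia.
case/subvPn => w; rewrite memv_cap => /andP [wW wU] wnU; exists w => //.
by rewrite tsing_add_line // sW.
Qed.

Lemma genP U : reflect (tsing U /\ forall W, tsing W -> (U <= W)%VS -> W = U) (gen U).
Proof.
apply: (iffP andP) => -[tU].
  move=> /eqP dU; split => // W tW UW; apply/esym/eqP.
  by rewrite eqEdim UW dU tsing_dim.
move=> hmax; split => //; rewrite eqn_leq tsing_dim // leqNgt; apply/negP => dU.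
have [w wU tw] := tsing_extend tU dU.
move/negP: wU; apply; rewrite -(hmax _ tw (addvSl _ _)).
by rewrite memvE addvSr.
Qed.

Lemma gen_perp x p : gen x -> sing p -> p \in x^! -> p \in x.
Proof.
move=> /genP [tx hmax] sp px; rewrite -(hmax _ (tsing_add_line tx sp px) (addvSl _ _)).
by rewrite memvE addvSr.
Qed.

Lemma gen_sub_eq x y : gen x -> gen y -> (x <= y)%VS -> x = y.
Proof. by move=> /genP [_ hx] /andP [ty _] xy; rewrite (hx y). Qed.

Lemma gen_orthov x W : gen x -> (W <= x)%VS -> (x <= W^!)%VS.
Proof.
by case/andP => /tsingP [_ px] _ Wx; apply: subv_trans px (orthovS Wx).
Qed.

Let card_q_gt0 : (0 < q)%N. Proof. by apply/card_gt0P; exists 0. Qed.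

Lemma card_affine U v : v \notin U^! ->
  #|[set w : V | (w \in U) && (h w v == 1)]| = (q ^ (\dim U).-1)%N.
Proof.
move=> hv; rewrite (eq_dim_orthov1 hv) -card_vspace.
case/mem_orthovPn: hv => u uU hu; pose w0 := (h u v)^-1 *: u.
have hw0 : h w0 v = 1.
  have hvu : h u v != 0 by rewrite herm_eq0C.
  by rewrite linearZl_LR /= mulVf.
have w0U : w0 \in U by rewrite memvZ.
rewrite -[RHS](card_imset _ (addrI w0)).
apply: eq_card => w; rewrite inE; apply/andP/imsetP.
  case=> wU /eqP hw; exists (w - w0); last by rewrite addrC subrK.
  by rewrite memv_cap memvB //= mem_orthov1 linearBl /= hw hw0 subrr.
case=> w'; rewrite memv_cap mem_orthov1 => /andP [w'U /eqP hw'] ->.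
by rewrite memvD // linearDl /= hw0 hw' addr0.
Qed.

Lemma two_d_le_n : (2 * d <= n)%N.
Proof.
have [W tW dW] := tsing_ex; have := dim_orthov tW.
by case/tsingP: tW => _ /dimvS; dimlia.
Qed.

Lemma gen_hyp_eq x H v : gen x -> (H <= x)%VS -> (\dim H).+1 = d ->
  v \in x -> v \notin H -> (H + <[v]>)%VS = x.
Proof.
move=> /andP [_ /eqP dx] Hx dH vx vH; apply/eqP.
rewrite eqEdim subv_add Hx -memvE vx /= dx -dH.
have := dimvS (addvSl H <[v]>%VS).
rewrite leq_eqVlt => /orP [/eqP e|//].
case/negP: vH; have /eqP -> : H == (H + <[v]>)%VS by rewrite eqEdim addvSl -e /=.
by rewrite memvE addvSr.
Qed.

(** Fix [v] in [x] outside [H]. Every other generator over [H] is [H + <[w]>] with [w] singular in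
    [H^!] and [h w v = 1]; such [w] are counted along the lines in direction [v] and by the
    generator they span with [H]. *)
Lemma card_gen_over x H : gen x -> (H <= x)%VS -> (\dim H).+1 = d ->
  #|[set z | [&& gen z, (H <= z)%VS & z != x]]| = (q ^ (n - 2 * d) * k)%N.
Proof.
move=> gx Hx dH; have /andP [tx /eqP dx] := gx.
have /tsingP [sx px] := tx.
have [v vx vH] : exists2 v, v \in x & v \notin H.
  by apply/subvPn; apply/negP => /dimvS; dimlia.
have xE := gen_hyp_eq gx Hx dH vx vH.
have tH := tsing_sub Hx tx.
have hvv : h v v = 0 by rewrite sing_isotropic // sx.
have vHo : v \in H^! by apply: (subvP (gen_orthov gx Hx)).
have dHo := dim_orthov tH; have dxo := dim_orthov tx.
pose T := [set w : V | (w \in H^!) && (h w v == 1)].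
pose S := [set w in T | sing w].
(* Otherwise [H^!] would lie in [x^!], which has smaller dimension. *)
have vHoo : v \notin H^!^!.
  rewrite mem_orthov_sym orthov_sym -memvE.
  apply/negP => hv; have : (H^! <= x^!)%VS.
    by rewrite -xE orthov_add subv_cap subvv orthov_sym -memvE.
  by move=> /dimvS; dimlia.
have cT : #|T| = (q ^ (n - d))%N by rewrite card_affine //; congr (_ ^ _)%N; dimlia.
(* Translation by [a *: v] permutes [T], and for each [w] in [T] exactly [k] values of [a] make
   [w + a *: v] singular. *)
have cS : (q * #|S| = k * #|T|)%N.
  transitivity (\sum_(a : F) \sum_(w in T) sing (w + a *: v)%R)%N; last first.
    rewrite exchange_big /= mulnC -sum_nat_const; apply: eq_bigr => w.
    rewrite inE => /andP [_ /eqP hw]; rewrite -(sing_line (sx _ vx) hw) -sum1_card.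
    by rewrite [RHS]big_mkcond; apply: eq_bigr => a _; rewrite inE; case: (sing _).
  rewrite -sum_nat_const; apply: eq_bigr => a _.
  rewrite -sum1_card (reindex_onto (fun w => w + a *: v) (fun w => w - a *: v)) /=; last first.
    by move=> w _; rewrite subrK.
  rewrite [LHS]big_mkcond [RHS]big_mkcond; apply: eq_bigr => w _.
  rewrite !inE addrK eqxx andbT linearDl linearZl_LR /= hvv mulr0 addr0.
  rewrite rpredDr ?memvZ //; case: (w \in _) => //=; case: (h w v == 1) => //=.
pose Z := [set z | [&& gen z, (H <= z)%VS & z != x]].
(* The fibre of [w |-> H + <[w]>] over [z] is the affine hyperplane [h w v = 1] of [z]. *)
have cZ : #|S| = (#|Z| * q ^ d.-1)%N.
  rewrite -sum_nat_const -sum1_card.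
  rewrite (partition_big (fun w => (H + <[w]>)%VS) (mem Z)) /=; last first.
    move=> w; rewrite !inE => /andP [/andP [wH /eqP hw] sw].
    have wnx : w \notin x.
      apply/negP => wx; have := gen_orthov gx (subvv x).
      move/orthovP => /(_ w v wx vx); rewrite hw => /eqP; rewrite oner_eq0 //.
    rewrite addvSl /gen tsing_add_line //=; apply/andP; split; last first.
      by apply: contraNneq wnx => <-; rewrite memvE addvSr.
    rewrite eqn_leq tsing_dim ?tsing_add_line //= -dH ltnNge; apply/negP => hd.
    have /eqP e : H == (H + <[w]>)%VS by rewrite eqEdim addvSl.
    by move/negP: wnx; apply; apply: (subvP Hx); rewrite e memvE addvSr.
  apply: eq_bigr => z; rewrite inE => /and3P [gz Hz zx].
  have /andP [tz /eqP dz] := gz; have /tsingP [sz pz] := tz.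
  have vz : v \notin z^!.
    apply/negP => vz; case/negP: zx; apply/eqP/esym/gen_sub_eq => //.
    by rewrite -xE subv_add Hz -memvE gen_perp ?sx.
  rewrite -dz -(card_affine vz) -sum1_card; apply: eq_bigl => w; rewrite !inE.
  apply/andP/andP.
    case=> /andP [/andP [wH hw] sw] /eqP <-; split => //.
    by rewrite memvE addvSr.
  case=> wz /eqP hw; have wHo := subvP (gen_orthov gz Hz) _ wz.
  rewrite wHo hw eqxx sz //; split=> //; apply/eqP/gen_hyp_eq => //.
  apply/negP => wH; have := subvP (gen_orthov gx Hx) _ vx.
  move/mem_orthovP => /(_ w wH) /eqP; rewrite herm_eq0C hw oner_eq0 //.
rewrite -/Z; have n2d := two_d_le_n.
apply/eqP; rewrite -(eqn_pmul2r (_ : 0 < q ^ d)%N) ?expn_gt0 ?card_q_gt0 //.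
apply/eqP; transitivity (q * #|S|)%N.
  by rewrite cZ -{1}(prednK d_gt0) expnS; ring.
rewrite cS cT mulnC mulnAC -expnD; congr (_ ^ _ * _)%N; dimlia.
Qed.

Definition hyperplanes x W : {set {vspace V}} :=
  [set H | [&& (H <= x)%VS, (\dim H).+1 == d & (W <= H)%VS]].

(* Every hyperplane of [x] is cut out by [q^(n-d+1) - q^(n-d)] vectors. *)
Lemma card_hyperplanes x W : gen x -> (W <= x)%VS ->
  (#|hyperplanes x W| * (q - 1) = q ^ (d - \dim W) - 1)%N.
Proof.
move=> gx Wx; have /andP [tx /eqP dx] := gx.
have dxo := dim_orthov tx.
have tW := tsing_sub Wx tx; have dWo := dim_orthov tW; have dWx := dimvS Wx.
have cD U : tsing U -> (U <= x)%VS ->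
    #|[set p : V | (p \in U^!) && (p \notin x^!)]| = (q ^ (n - \dim U) - q ^ (n - d))%N.
  move=> tU Ux; have dU := dim_orthov tU.
  rewrite (_ : n - \dim U = \dim U^!)%N; last by dimlia.
  rewrite (_ : n - d = \dim x^!)%N; last by dimlia.
  rewrite -!card_vspace; have -> : #|x^!| = #|[predI U^! & x^!]|.
    apply: eq_card => p; rewrite !inE.
    by rewrite andbC andb_idr //; apply/subvP/orthovS.
  rewrite -(cardID (mem x^!) (mem U^!)) addKn.
  by apply: eq_card => p; rewrite !inE andbC.
have := cD W tW Wx; rewrite -sum1_card.
rewrite (partition_big (fun p => (x :&: <[p]>^!)%VS) (mem (hyperplanes x W))) /=; last first.
  move=> p; rewrite !inE => /andP [pW px].
  rewrite capvSl -(eq_dim_orthov1 px) dx prednK // eqxx subv_cap Wx /=.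
  by rewrite orthov_sym -memvE.
rewrite (eq_bigr (fun _ => q ^ (n - d.-1) - q ^ (n - d)))%N; last first.
  move=> H; rewrite inE => /and3P [Hx /eqP dH WH].
  have tH := tsing_sub Hx tx.
  rewrite (_ : d.-1 = \dim H); last by rewrite -dH.
  rewrite -(cD H tH Hx) -sum1_card; apply: eq_bigl => p; rewrite !inE.
  apply/andP/andP.
    case=> /andP [pW px] /eqP <-; split=> //.
    by rewrite memvE orthov_sym capvSr.
  case=> pH px; rewrite px (subvP (orthovS WH) _ pH); split=> //.
  rewrite eq_sym eqEdim subv_cap Hx orthov_sym -memvE pH /=.
  by rewrite -(eq_dim_orthov1 px) dx -dH.
rewrite sum_nat_const => e.
apply/eqP; rewrite -(eqn_pmul2r (_ : 0 < q ^ (n - d))%N) ?expn_gt0 ?card_q_gt0 //.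
rewrite -mulnA !mulnBl !mul1n -expnS -expnD.
have n2d := two_d_le_n.
rewrite (_ : (n - d).+1 = n - d.-1)%N; last by dimlia.
by rewrite (_ : d - \dim W + (n - d) = n - \dim W)%N; [rewrite e | dimlia].
Qed.

Definition nbrs x : {set {vspace V}} :=
  [set z | gen z && ((\dim (x :&: z)%VS).+1 == d)].

Lemma cap_gen_hyp x z H : gen x -> gen z -> (H <= x)%VS -> (H <= z)%VS ->
  (\dim H).+1 = d -> z != x -> (x :&: z)%VS = H.
Proof.
move=> gx gz Hx Hz dH zx; apply/esym/eqP; rewrite eqEdim subv_cap Hx Hz /=.
rewrite -ltnS dH; have /andP [_ /eqP dx] := gx.
have := dimvS (capvSl x z); rewrite dx leq_eqVlt => /orP [/eqP e|//].
case/negP: zx; apply/eqP/esym/gen_sub_eq => //; apply/capv_idPl/eqP.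
by rewrite eqEdim capvSl e dx leqnn.
Qed.

Lemma nbrs_hyp x W (P : pred {vspace V}) : gen x -> (W <= x)%VS ->
  #|[set z in nbrs x | (W <= z)%VS && P z]| =
  (\sum_(H in hyperplanes x W) #|[set z | [&& gen z, (H <= z)%VS, z != x & P z]]|)%N.
Proof.
move=> gx Wx; rewrite -sum1_card.
rewrite (partition_big (fun z => (x :&: z)%VS) (mem (hyperplanes x W))) /=; last first.
  move=> z; rewrite !inE => /and3P [/andP [gz dz] Wz _].
  by rewrite capvSl dz subv_cap Wx Wz.
apply: eq_bigr => H; rewrite inE => /and3P [Hx /eqP dH WH].
rewrite -sum1_card; apply: eq_bigl => z; rewrite !inE.
apply/andP/and4P.
  case=> /and3P [/andP [gz /eqP dz] Wz Pz] /eqP e; split=> //.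
    by rewrite -e capvSr.
  apply/eqP => zx; move: dz; rewrite zx capvv.
  by have /andP [_ /eqP ->] := gx; dimlia.
case=> gz Hz zx Pz; rewrite (cap_gen_hyp gx gz Hx Hz dH zx) dH gz Pz !eqxx /= andbT.
by rewrite (subv_trans WH Hz).
Qed.

Lemma card_nbrs_over x W : gen x -> (W <= x)%VS ->
  #|[set z in nbrs x | (W <= z)%VS]| = (#|hyperplanes x W| * (q ^ (n - 2 * d) * k))%N.
Proof.
move=> gx Wx; have := nbrs_hyp (fun _ => true) gx Wx.
rewrite (eq_bigr (fun _ => q ^ (n - 2 * d) * k))%N.
  by rewrite sum_nat_const => <-; apply: eq_card => z; rewrite !inE andbT.
move=> H; rewrite inE => /and3P [Hx /eqP dH WH]; rewrite -(card_gen_over gx Hx dH).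
by apply: eq_card => z; rewrite !inE andbT.
Qed.

(** With [H = x :&: z] and [W = x :&: y] one has [x = H + W]. Vectors of [z :&: y] are orthogonal to
    both, so they lie in [x] by maximality; hence [z :&: y = H :&: W], a hyperplane of [W]. *)
Lemma nbr_far x y z : gen x -> gen y -> z \in nbrs x -> ~~ (x :&: y <= z)%VS ->
  (\dim (z :&: y)%VS).+1 = \dim (x :&: y)%VS.
Proof.
rewrite inE => gx gy /andP [gz /eqP dxz] nWz.
have [/andP [tx /eqP dx] /andP [ty _] /andP [tz _]] := And3 gx gy gz.
have /tsingP [sz _] := tz.
set W := (x :&: y)%VS in nWz *; set H := (x :&: z)%VS in dxz *.
have nWH : ~~ (W <= H)%VS by apply: contra nWz => /subv_trans; apply; apply: capvSr.
have HWx : (H + W = x)%VS.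
  apply/eqP; rewrite eqEdim subv_add !capvSl dx -dxz /= ltnNge.
  apply: contra nWH => le; have /eqP -> : H == (H + W)%VS by rewrite eqEdim addvSl.
  exact: addvSr.
have zyH : (z :&: y <= H)%VS.
  apply/subvP => p; rewrite memv_cap => /andP [pz py].
  rewrite memv_cap pz andbT gen_perp ?sz // -HWx orthov_add memv_cap.
  rewrite (subvP (gen_orthov gz (capvSr x z)) _ pz).
  exact: (subvP (gen_orthov gy (capvSr x y)) _ py).
have -> : (z :&: y = H :&: W)%VS.
  apply/eqP; rewrite eqEsubv; apply/andP; split.
    rewrite subv_cap zyH /= /W subv_cap capvSr andbT.
    exact: subv_trans zyH (capvSl _ _).
  rewrite subv_cap (subv_trans (capvSl H W) (capvSr x z)) /=.
  exact: subv_trans (capvSr H W) (capvSr x y).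
have := dimv_sum_cap H W; rewrite HWx dx; dimlia.
Qed.

Section Near.
Variables x y H : {vspace V}.
Hypotheses (gx : gen x) (gy : gen y) (Hx : (H <= x)%VS) (dH : (\dim H).+1 = d).
Hypothesis WH : (x :&: y <= H)%VS.
(** [H + D] is the projection of [y] onto the pencil of generators through [H]: its unique member
    closer to [y] than [x]. *)
Let D := (y :&: H^!)%VS.

Let HyE : (H :&: y = x :&: y)%VS.
Proof.
apply/eqP; rewrite eqEsubv !subv_cap capvSr WH capvSr andbT /=.
by rewrite (subv_trans (capvSl _ _) Hx).
Qed.

Let WD : (x :&: y <= D)%VS.
Proof.
by rewrite subv_cap capvSr (subv_trans (capvSl _ _) (gen_orthov gx Hx)).
Qed.

Let tHD : tsing (H + D).
Proof.
have [/andP [tx _] /andP [ty _]] := (gx, gy).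
apply: tsing_sum; first exact: tsing_sub Hx tx.
  exact: tsing_sub (capvSl _ _) ty.
exact: capvSr.
Qed.

Let HDE : (H :&: D = x :&: y)%VS.
Proof.
apply/eqP; rewrite eqEsubv [X in _ && X]subv_cap WD WH !andbT -HyE.
by rewrite capvS // capvSl.
Qed.

Let dimD : \dim D = (\dim (x :&: y)%VS).+1.
Proof.
have /andP [_ /eqP dy] := gy.
have := dimv_sum_cap H D; rewrite HDE; have := tsing_dim tHD.
have := @dim_cap_orthov_rel y H (x :&: y)%VS WH.
by rewrite orthov_sym -/D dy => /(_ (gen_orthov gy (capvSr _ _))); dimlia.
Qed.

Let gHD : gen (H + D).
Proof.
rewrite /gen tHD /=; apply/eqP.
by have := dimv_sum_cap H D; rewrite HDE dimD; dimlia.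
Qed.

(** The intersection is squeezed between [x :&: y] and [D], whose dimensions differ by one. *)
Lemma nbr_near z : gen z -> (H <= z)%VS ->
  \dim (z :&: y)%VS = \dim (x :&: y)%VS \/ \dim (z :&: y)%VS = (\dim (x :&: y)%VS).+1.
Proof.
move=> gz Hz; have : (x :&: y <= z :&: y)%VS by rewrite -HyE capvS.
have : (z :&: y <= D)%VS.
  by rewrite subv_cap capvSr (subv_trans (capvSl _ _) (gen_orthov gz Hz)).
by move=> /dimvS h1 /dimvS; move: h1; rewrite dimD; dimlia.
Qed.

Lemma card_nbr_closer :
  #|[set z | [&& gen z, (H <= z)%VS, z != x &
     \dim (z :&: y)%VS == (\dim (x :&: y)%VS).+1]]| = 1%N.
Proof.
apply/eqP/cards1P; exists (H + D)%VS; apply/setP => z; rewrite !inE.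
apply/and4P/eqP.
  case=> gz Hz _ /eqP dz; apply/esym/gen_sub_eq => //.
  rewrite subv_add Hz /=; suff <- : (z :&: y = D)%VS by apply: capvSl.
  apply/eqP; rewrite eqEdim dz dimD leqnn andbT subv_cap capvSr.
  exact: subv_trans (capvSl _ _) (gen_orthov gz Hz).
move=> ->; rewrite gHD addvSl; split=> //.
  apply/eqP => e; have : (D <= x :&: y)%VS by rewrite subv_cap -e addvSr capvSl.
  by move=> /dimvS; rewrite dimD ltnn.
rewrite -dimD; apply/eqP; congr (\dim _); apply/eqP.
rewrite eqEsubv !subv_cap capvSr addvSr capvSl /=.
rewrite andbT; exact: subv_trans (capvSl _ _) (gen_orthov gHD (addvSl _ _)).
Qed.

End Near.

Lemma card_nbrs_closer x y : gen x -> gen y ->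
  #|[set z in nbrs x | (x :&: y <= z)%VS &&
     (\dim (z :&: y)%VS == (\dim (x :&: y)%VS).+1)]| = #|hyperplanes x (x :&: y)%VS|.
Proof.
move=> gx gy; rewrite (nbrs_hyp _ gx (capvSl _ _)) -sum1_card.
apply: eq_bigr => H; rewrite inE => /and3P [Hx /eqP dH WH].
exact: card_nbr_closer.
Qed.

(** Neighbours not containing [x :&: y] move away from [y]; among the others, each hyperplane of [x]
    through [x :&: y] contributes one that moves closer, and the rest keep the distance. *)
Lemma card_nbrs_at (R : realType) x y (s : nat) : gen x -> gen y ->
  #|[set z in nbrs x | (d - \dim (z :&: y)%VS)%N == s]|%:R =
  intersection_number q%:R (q ^ (n - 2 * d) * k)%:R d s (d - \dim (x :&: y)%VS) :> R.
Proof.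
move=> gx gy; set W := (x :&: y)%VS; set i := (d - \dim W)%N.
have /andP [_ /eqP dx] := gx.
have dW : (\dim W <= d)%N by rewrite -dx dimvS ?capvSl.
have Wx : (W <= x)%VS := capvSl _ _.
set E := (q ^ (n - 2 * d) * k)%N.
have q_gt1 : (1 < q)%N := finNzRing_gt1 F.
have hq : q%:R - 1 != 0 :> R by rewrite subr_eq0 pnatr_eq1 gtn_eqF.
have chyp U : (U <= x)%VS ->
    #|hyperplanes x U|%:R = (q%:R ^+ (d - \dim U) - 1) / (q%:R - 1) :> R.
  move=> Ux; apply: (mulIf hq); rewrite divfK //.
  have := card_hyperplanes gx Ux => /(congr1 (fun m => m%:R : R)).
  by rewrite natrM !natrB ?natrX ?expn_gt0 // ltnW.
pose N0 := [set z in nbrs x | ~~ (W <= z)%VS].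
pose N1 := [set z in nbrs x | (W <= z)%VS].
pose N2 := [set z in nbrs x | (W <= z)%VS && (\dim (z :&: y)%VS == (\dim W).+1)].
have c1 : #|N1|%:R = E%:R * ((q%:R ^+ i - 1) / (q%:R - 1)) :> R.
  by rewrite card_nbrs_over // -/E natrM chyp // mulrC.
have c2 : #|N2|%:R = (q%:R ^+ i - 1) / (q%:R - 1) :> R.
  by rewrite card_nbrs_closer // chyp.
have c0 : #|N0|%:R = E%:R * ((q%:R ^+ d - q%:R ^+ i) / (q%:R - 1)) :> R.
  (* The zero subspace in [card_nbrs_over] counts all neighbours, so [N0] follows by subtraction. *)
  have : (#|N0| + #|N1| = #|[set z in nbrs x | (0 <= z)%VS]|)%N.
    rewrite addnC -(cardsID [set z | (W <= z)%VS] [set z in nbrs x | (0 <= z)%VS]).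
    congr (_ + _)%N; apply: eq_card => z; rewrite !inE sub0v andbT //.
    by rewrite andbC.
  move=> /(congr1 (fun m => m%:R : R)); rewrite natrD c1.
  rewrite card_nbrs_over ?sub0v // -/E natrM chyp ?sub0v // dimv0 subn0 => e.
  by rewrite -[LHS](addrK (E%:R * ((q%:R ^+ i - 1) / (q%:R - 1)))) e; ring.
have sN2 : N2 \subset N1.
  by apply/subsetP => z; rewrite !inE => /and3P [-> ->].
have zfar z : z \in N0 -> (d - \dim (z :&: y)%VS)%N = i.+1.
  rewrite inE => /andP [zx Wz]; have := nbr_far gx gy zx Wz.
  by rewrite -/W /i; dimlia.
have znear z : z \in N1 :\: N2 -> (d - \dim (z :&: y)%VS)%N = i.
  rewrite !inE => /andP [hn /andP [hz Wz]].
  have /andP [gz /eqP dz] := hz.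
  have WH : (x :&: y <= x :&: z)%VS by rewrite subv_cap Wx Wz.
  have := nbr_near gx gy (capvSl x z) dz WH gz (capvSr x z).
  case=> e; first by rewrite e.
  by move: hn; rewrite hz Wz -/W e eqxx.
have zcl z : z \in N2 -> (d - \dim (z :&: y)%VS).+1 = i.
  rewrite inE => /and3P [hz Wz /eqP e]; rewrite e.
  suff : (\dim W < d)%N by rewrite /i; dimlia.
  rewrite -e; move: hz; rewrite inE => /andP [/andP [_ /eqP <-] _].
  by rewrite dimvS // capvSl.
have -> : [set z in nbrs x | (d - \dim (z :&: y)%VS)%N == s] =
   [set z in N0 | i.+1 == s] :|: ([set z in N1 :\: N2 | i == s] :|: [set z in N2 | i == s.+1]).
  apply/setP => z; rewrite !inE.
  have := (zfar z, znear z, zcl z); rewrite !inE.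
  case: (gen z && _) => //=; case: (W <= z)%VS => //=; last first.
    by case=> -[/(_ isT) -> _ _]; rewrite orbF.
  case: (_ == (\dim W).+1) => /=.
    by case=> -[_ _ /(_ isT) e]; rewrite -e eqSS.
  by case=> -[_ /(_ isT) -> _]; rewrite orbF.
have cif (A : {set {vspace V}}) (b : bool) : #|[set z in A | b]|%:R = b%:R * #|A|%:R :> R.
  case: b; rewrite ?mul1r ?mul0r.
    by congr _%:R; apply: eq_card => z; rewrite !inE andbT.
  by rewrite (_ : [set z in A | false] = set0) ?cards0 //; apply/setP => z; rewrite !inE andbF.
rewrite !cardsU.
rewrite (_ : _ :&: (_ :|: _) = set0); last first.
  apply/setP => z; rewrite !inE.
  by case: (W <= z)%VS; rewrite ?andbF ?andFb //= ?andbF.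
rewrite (_ : _ :&: [set z in N2 | _] = set0); last first.
  apply/setP => z; rewrite !inE.
  case: (gen z && _) => //=; case: (W <= z)%VS => //=.
  by case: (_ == (\dim W).+1); rewrite //= ?andbF.
rewrite !cards0 !subn0 !natrD !cif c0 c2.
have -> : #|N1 :\: N2|%:R =
    E%:R * ((q%:R ^+ i - 1) / (q%:R - 1)) - (q%:R ^+ i - 1) / (q%:R - 1) :> R.
  have := cardsID N2 N1; rewrite (setIidPr sN2) => /(congr1 (fun m => m%:R : R)).
  by rewrite natrD c1 c2 => <-; ring.
rewrite /intersection_number !(eq_sym s) (eq_sym s.+1).
by field.
Qed.

End PolarGeometry.

(** * Quadratic, symplectic and Hermitian forms *)

Section FormTypes.
Variables (F : finFieldType) (n : nat).
Local Notation V := 'rV[F]_n.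

(** Distance-regularity as the spectral part uses it; the natural number [E] stands for [q^eps]. *)
Definition regular_generators (f : form_on F n) (d E : nat) : Prop :=
  [/\ forall U, is_generator f U -> \dim U = d,
      exists U, is_generator f U &
      forall (R : realType) x y (s : nat), is_generator f x -> is_generator f y ->
      #|[set z | [&& is_generator f z, (\dim (x :&: z)%VS).+1 == d &
                     (d - \dim (z :&: y)%VS)%N == s]]|%:R =
      intersection_number #|F|%:R E%:R d s (d - \dim (x :&: y)%VS) :> R].

Lemma tsing_regular (f : form_on F n) (eps : bool) (theta : {rmorphism F -> F})
    (h : {hermitian V for eps & theta}) (sing : pred V) (d k : nat) :
  (0 < d)%N -> witt_index f = d ->
  (forall U, totally_singular f U = tsing h sing U) ->
  sing 0 ->
  (forall (a : F) u v, sing u -> sing v -> h u v = 0 -> sing (a *: u + v)) ->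
  (forall u, sing u -> h u u = 0) ->
  (forall v, sing v -> (forall w, h w v = 0) -> v = 0) ->
  (forall v w, sing v -> h w v = 1 -> #|[set a : F | sing (w + a *: v)]| = k) ->
  regular_generators f d (#|F| ^ (n - 2 * d) * k).
Proof.
move=> d0 hd hts s0 slin siso snd sline.
have tdim U : tsing h sing U -> (\dim U <= d)%N.
  by rewrite -hts -hd => tU; rewrite /witt_index; apply: leq_bigmax_cond.
have ts0 : tsing h sing 0%VS.
  by apply/tsingP; split; rewrite ?sub0v // => u; rewrite memv0 => /eqP ->.
have tex : exists2 U, tsing h sing U & \dim U = d.
  have [|U tU eU] := @eq_bigmax_cond _ (totally_singular f) (fun U => \dim U).
    by apply/card_gt0P; exists 0%VS; have := ts0; rewrite -hts.
  exists U; first by rewrite -hts.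
  by rewrite -eU -hd.
have genE U : is_generator f U = gen h sing d U.
  apply/andP/(genP slin siso tdim tex d0) => -[tU hU].
    rewrite -hts; split=> // W tW UW; move/forallP: hU => /(_ W).
    by rewrite hts tW UW => /eqP.
  rewrite hts; split=> //; apply/forallP => W; apply/implyP => tW.
  by apply/implyP => UW; apply/eqP/hU; rewrite -?hts.
split.
- by move=> U; rewrite genE => /andP [_ /eqP].
- by have [U tU dU] := tex; exists U; rewrite genE /gen tU dU eqxx.
move=> R x y s; rewrite !genE => gx gy.
rewrite -(card_nbrs_at slin siso snd sline tdim tex d0 R s gx gy).
by congr _%:R; apply: eq_card => z; rewrite !inE genE andbA.
Qed.

Section Quadratic.
Variable Q : V -> F.
Hypothesis Q_quad : quadratic_form Q.

(** Depending on the proof that [Q] is quadratic lets the bilinear and Hermitian instances be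
    attached to the polarization. *)
Definition polar_form of quadratic_form Q : V -> V -> F := polarization Q.
Local Notation B := (polar_form Q_quad).

Let B_bilinear : bilinear_for
  (GRing.Scale.Law.clone F F *%R _) (GRing.Scale.Law.clone F F (idfun \; *%R) _) B.
Proof. have [_ [hl hr]] := Q_quad; split=> u; [apply: hl | apply: hr]. Qed.

HB.instance Definition _ := bilinear_isBilinear.Build F V V F
  (GRing.Scale.Law.clone F F *%R _) (GRing.Scale.Law.clone F F (idfun \; *%R) _) B
  B_bilinear.

Let B_sym u v : B u v = (-1) ^+ false * idfun (B v u).
Proof. by rewrite expr0 mul1r /= /polar_form /polarization [v + u]addrC; ring. Qed.

HB.instance Definition _ := isHermitianSesquilinear.Build F V false idfun B B_sym.

End Quadratic.

Lemma quadraticD (Q : V -> F) u v : Q (u + v) = Q u + Q v + polarization Q u v.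
Proof. by rewrite /polarization; ring. Qed.

Lemma quadratic_regular (Q : V -> F) (d : nat) :
  (0 < d)%N -> nondegenerate_form (QuadraticForm Q) ->
  witt_index (QuadraticForm Q) = d ->
  regular_generators (QuadraticForm Q) d (#|F| ^ (n - 2 * d)).
Proof.
move=> d0 [hQ ns] hd.
pose h : {hermitian V for false & idfun} := polar_form hQ.
have hE u v : h u v = polarization Q u v by [].
have [QZ [Bl Br]] := hQ.
have hZl a u v : h (a *: u) v = a * h u v by rewrite linearZl_LR.
have hC u v : h u v = h v u by rewrite hermC mul1r.
have Q0 : Q 0 = 0 by rewrite -(scale0r 0) QZ expr0n mul0r.
rewrite -[X in regular_generators _ _ X]muln1.
apply: (@tsing_regular _ false idfun h (fun u => Q u == 0)) => //.
- move=> U /=; rewrite /tsing; apply/idP/andP => [hU|[]//]; split=> //.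
  have {}hU u : u \in U -> Q u = 0.
    by move=> uU; move/forallP: hU => /(_ u); rewrite uU => /eqP.
  apply/orthovP => u v uU vU.
  by rewrite hE /polarization !hU ?memvD // !subr0.
- by rewrite Q0.
- move=> a u v /eqP qu /eqP qv huv.
  by rewrite quadraticD QZ qu qv -hE hZl huv !mulr0 !addr0.
- move=> u /eqP qu; rewrite hE /polarization.
  have -> : u + u = (1 + 1) *: u by rewrite scalerDl scale1r.
  by rewrite QZ qu mulr0 !subr0.
- by move=> v /eqP qv hv; apply: ns => // w; rewrite -hE hC.
(* Here [Q (w + a *: v) = Q w + a], so [a = - Q w] is the only solution and [k = 1]. *)
- move=> v w /eqP qv hwv; apply: (etrans _ (cards1 (- Q w))); apply: eq_card => a.
  rewrite !inE.
  rewrite quadraticD QZ qv mulr0 addr0 -hE hC hZl hC hwv mulr1.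
  by rewrite addrC addr_eq0.
Qed.

Lemma symplectic_regular (b : {skew_symmetric V}) (d : nat) :
  (0 < d)%N -> nondegenerate_form (SymplecticForm b) ->
  witt_index (SymplecticForm b) = d ->
  regular_generators (SymplecticForm b) d (#|F| ^ (n - 2 * d) * #|F|).
Proof.
move=> d0 [nd _ char2] hd.
(* Skew-symmetry gives [b u u *+ 2 = 0]; characteristic 2 is covered by the definition of a
   symplectic form. *)
have alt u : b u u = 0.
  case: (boolP (2 \in [pchar F])) => [/char2 // | h2].
  have : b u u *+ 2 = 0 by rewrite mulr2n {1}hermC /= mulN1r addNr.
  move/eqP; rewrite -mulr_natr mulf_eq0 => /orP [/eqP // | e2].
  by move: h2; rewrite inE /= e2.
apply: (@tsing_regular _ true idfun b xpredT) => //.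
- move=> U; rewrite /tsing /=; case: (U <= _)%VS; rewrite ?andbF // andbT.
  by apply/esym/forallP => u; rewrite implybT.
- move=> v _ hv; apply/eqP; rewrite -memv0 -(eqP nd); apply/mem_orthovP => w _.
  by apply/eqP; rewrite herm_eq0C hv.
- by move=> v w _ _; rewrite -[RHS]cardsT; apply: eq_card => a; rewrite !inE.
Qed.

(* Surjectivity of the trace onto the fixed field, and multiplication by an
   element [a - theta a], which swaps the fixed field and the trace kernel. *)
Lemma card_trace_fiber (theta : involutive_rmorphism F) : ~ (theta =1 id) ->
  exists2 k : nat, (k * k)%N = #|F| &
    forall c, theta c = c -> #|[set a | a + theta a == c]| = k.
Proof.
move=> nid; have thK : involutive theta := rmorphK theta.
pose K := [set a | theta a == - a]; pose F0 := [set a | theta a == a].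
have [a ha] : exists a, theta a != a.
  by apply/existsP; rewrite -negb_forall; apply/negP => /forallP h; apply: nid => a; apply/eqP.
pose del := a - theta a.
have del0 : del != 0 by rewrite subr_eq0 eq_sym.
have tdel : theta del = - del by rewrite rmorphB /= thK opprB.
(* A trace vanishing everywhere would give [1 + 1 = 0] at 1, and then [theta] would be the
   identity. *)
have [b hb] : exists b, b + theta b != 0.
  apply/existsP; rewrite -negb_forall; apply/negP => /forallP h; apply: nid => c.
  have h1 := h 1; have hc := h c.
  rewrite rmorph1 in h1; move: hc; rewrite addr_eq0 => /eqP hc.
  rewrite -[theta c]opprK -hc; apply/eqP; rewrite eq_sym -subr_eq0 opprK.
  by rewrite -[c]mulr1 -mulrDr (eqP h1) mulr0.
have tb : theta (b + theta b) = b + theta b by rewrite rmorphD /= thK addrC.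
have fib c : theta c = c -> #|[set a | a + theta a == c]| = #|K|.
  move=> hc; pose l := b * (c / (b + theta b)).
  have tl : l + theta l = c.
    by rewrite /l !rmorphM fmorphV /= tb hc -mulrDl mulrC divfK.
  rewrite -[RHS](card_imset _ (addrI l)); apply: eq_card => e; rewrite inE.
  apply/eqP/imsetP => [he|[e' + ->]].
    exists (e - l); last by rewrite addrC subrK.
    by rewrite inE -subr_eq0 opprK rmorphB addrC addrACA he -opprD tl subrr.
  by rewrite inE => /eqP he'; rewrite rmorphD /= he' addrACA subrr addr0.
exists #|K| => //.
have cK : #|K| = #|F0|.
  rewrite -[RHS](card_imset _ (mulfI del0)); apply: eq_card => e; rewrite inE.
  apply/eqP/imsetP => [he|[e' + ->]].
    exists (del^-1 * e); last by rewrite mulrA mulfV // mul1r.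
    by rewrite inE rmorphM fmorphV /= tdel he invrN mulrNN.
  by rewrite inE => /eqP he'; rewrite rmorphM /= tdel he' mulNr.
rewrite {2}cK mulnC -sum_nat_const -[RHS]cardsT -[RHS]sum1_card.
rewrite [RHS](partition_big (fun e => e + theta e) (mem F0)) /=; last first.
  by move=> e _; rewrite inE rmorphD /= thK addrC.
apply: eq_bigr => c; rewrite inE => /eqP hc; rewrite -(fib c hc) -sum1_card.
by apply: eq_bigl => e; rewrite !inE.
Qed.

Lemma hermitian_regular (theta : involutive_rmorphism F)
    (h : {hermitian_sym V for theta}) (d : nat) :
  (0 < d)%N -> nondegenerate_form (HermitianForm h) ->
  witt_index (HermitianForm h) = d ->
  exists2 k : nat, (k * k)%N = #|F| &
    regular_generators (HermitianForm h) d (#|F| ^ (n - 2 * d) * k).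
Proof.
move=> d0 [nid [nd _]] hd; have [k kk fib] := card_trace_fiber nid.
exists k => //.
apply: (@tsing_regular _ false theta h (fun u => h u u == 0)) => //.
- move=> U /=; rewrite /tsing andbC; case: (boolP (U <= _)%VS) => //= /orthovP hU.
  by apply/esym/forallP => u; apply/implyP => uU; rewrite hU.
- by rewrite linear0r.
- move=> a u v /eqP hu /eqP hv huv; rewrite hnormD /= linearZl_LR linearZr_LR /=.
  by rewrite linearZl_LR /= hu hv huv !mulr0 rmorph0 mulr0 !addr0.
- by move=> u /eqP.
- move=> v _ hv; apply/eqP; rewrite -memv0 -(eqP nd); apply/mem_orthovP => w _.
  by apply/eqP; rewrite herm_eq0C hv.
(* The norm of [w + a *: v] is [h w w + a + theta a], so the admissible [a] form a trace fibre. *)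
- move=> v w /eqP hv hwv.
  have hww : theta (- h w w) = - h w w by rewrite rmorphN {2}hermC mul1r.
  rewrite -(fib _ hww); apply: eq_card => a; rewrite !inE.
  rewrite hnormD /= linearZl_LR !linearZr_LR /= hv hwv !mulr0 addr0 mulr1 mul1r.
  by rewrite (rmorphK theta) [theta a + a]addrC [X in X == 0]addrC addr_eq0.
Qed.

End FormTypes.

(** With [n] the ambient dimension, $E=q^{n-2d}k$: [eps] is [n - 2d] plus 0, 1/2 or 1, according to
    [k] being 1, $\sqrt q$ or [q]. *)
Lemma polar_space_regular (R : realType) (F : finFieldType) (ty : polar_type) (d : nat)
    (f : form_on F (ambient_dim ty d)) :
  (0 < d)%N -> is_polar_space f ->
  exists2 E : nat, E%:R = #|F|%:R `^ polar_eps R ty & regular_generators f d E.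
Proof.
move=> d0 [hty hnd hw]; set q := #|F|.
have q0 : (0 < q)%N by apply/card_gt0P; exists 0.
have qR : q%:R != 0 :> R by rewrite pnatr_eq0 -lt0n.
have half k : (k * k)%N = q -> k%:R = q%:R `^ (1 / 2) :> R.
  move=> kk; rewrite -kk natrM -expr2 -powR_mulrn // -powRrM div1r mulfV ?pnatr_eq0 //.
  by rewrite powRr1.
case: ty f hty hnd hw => -[Q|b|theta h] //= _ hnd hw.
- exists (q ^ (2 * d - 2 * d))%N; last exact: quadratic_regular.
  by rewrite subnn powRr0.
- have [k kk hr] := hermitian_regular d0 hnd hw; exists (q ^ (2 * d - 2 * d) * k)%N => //.
  by rewrite subnn mul1n (half k kk).
- exists (q ^ ((2 * d).+1 - 2 * d))%N; last exact: quadratic_regular.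
  by rewrite subSnn powRr1.
- exists (q ^ (2 * d - 2 * d) * q)%N; last exact: symplectic_regular.
  by rewrite subnn mul1n powRr1.
- have [k kk hr] := hermitian_regular d0 hnd hw.
  exists (q ^ ((2 * d).+1 - 2 * d) * k)%N => //.
  rewrite subSnn natrM (half k kk) expn1 -{1}(powRr1 (ler0n R q)) -powRD ?qR ?implybT //.
  by congr (_ `^ _); field.
- exists (q ^ ((2 * d).+2 - 2 * d))%N; last exact: quadratic_regular.
  by rewrite (_ : (2 * d).+2 - 2 * d = 2)%N ?natrX ?powR_mulrn //; lia.
Qed.

Lemma lambda_min_attained (R : realType) (d t : nat) (q eps : R) :
  exists2 r, (r <= d)%N & lambda_min d t q eps = lambda d q eps (d - t - 1) r.
Proof.
rewrite /lambda_min big_nat; apply: (big_ind (fun x => exists2 r, (r <= d)%N & x = _)).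
- by exists 0%N.
- by move=> x y hx hy; rewrite minEle; case: ifP.
- by move=> r hr; exists r.
Qed.

Lemma lambda_min_le (R : realType) (d t : nat) (q eps : R) r : (r <= d)%N ->
  lambda_min d t q eps <= lambda d q eps (d - t - 1) r.
Proof.
by move=> rd; apply: ge_bigmin_seq => //; rewrite mem_index_iota.
Qed.

(** Taking [e * q ^+ i] out of each factor leaves the prefactor that is the lower bound in
    [lambda0_ge], so the two cancel in the ratio bound. *)
Lemma horner_qprod1 (R : realType) (q e : R) n : q != 0 -> e != 0 ->
  (qprod q e n).[1] = e ^+ n * q ^+ 'C(n, 2) * \prod_(i < n) (1 + e^-1 * q^-1 ^+ i).
Proof.
move=> q0 e0; elim: n => [|n IHn]; first by rewrite qprod0 hornerC big_ord0 !mulr1.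
rewrite qprodSr hornerM IHn !hornerE big_ord_recr /= binS bin1 exprD exprS exprVn.
by field; rewrite e0 expf_neq0.
Qed.

(** * The distance on generators, indexed by ordinals *)

Section GeneratorGraph.
Variables (R : realType) (F : finFieldType) (n : nat) (f : form_on F n) (d E : nat).
Hypotheses (d_gt0 : (0 < d)%N) (reg : regular_generators f d E).

Let m := #|{: generator f}|.
Definition gdist (x y : 'I_m) : nat := meet_codim d (enum_val x) (enum_val y).

Let dimg (x : generator f) : \dim (val x) = d.
Proof. by case: reg => h _ _; apply/h/valP. Qed.

Let dim_capg (x y : generator f) : (\dim (val x :&: val y)%VS <= d)%N.
Proof. by rewrite -(dimg x) dimvS // capvSl. Qed.

Lemma generators_gt0 : (0 < m)%N.
Proof. by case: reg => _ [U hU] _; apply/card_gt0P; exists (Sub U hU). Qed.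

Lemma gdist_sym x y : gdist x y = gdist y x.
Proof. by rewrite /gdist /meet_codim capvC. Qed.

Lemma gdist_le x y : (gdist x y <= d)%N.
Proof. exact: leq_subr. Qed.

Lemma gdist_eq0 x y : (gdist x y == 0%N) = (x == y).
Proof.
rewrite /gdist /meet_codim subn_eq0 -(inj_eq enum_val_inj) -val_eqE /=.
set X := val (enum_val x); set Y := val (enum_val y).
have [dX dY] : \dim X = d /\ \dim Y = d by split; apply: dimg.
apply/idP/eqP => [hd|->]; last by rewrite capvv dY.
have hX : (X :&: Y)%VS = X by apply/eqP; rewrite eqEdim capvSl dX.
have hY : (X :&: Y)%VS = Y by apply/eqP; rewrite eqEdim capvSr dY.
by rewrite -hX hY.
Qed.

Lemma gdist_regular x y (s : nat) :
  #|[set z | (gdist x z == 1%N) && (gdist z y == s)]|%:R =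
  intersection_number #|F|%:R E%:R d s (gdist x y) :> R.
Proof.
case: reg => _ _ hr.
rewrite /gdist /meet_codim -(hr R _ _ s (valP (enum_val x)) (valP (enum_val y))).
have inj : injective (fun z : 'I_m => val (enum_val z)).
  by move=> z1 z2 /val_inj /enum_val_inj.
rewrite -(card_imset _ inj); congr _%:R; apply: eq_card => U; rewrite inE.
have one (W : {vspace 'rV[F]_n}) : (\dim W <= d)%N ->
    ((d - \dim W)%N == 1%N) = ((\dim W).+1 == d).
  by move: (\dim W) => w hw; lia.
apply/imsetP/and3P => [[z]|[gU hd hs]].
  rewrite inE => /andP [h1 h2] ->; split=> //; first exact: valP.
  by rewrite -one ?dim_capg.
exists (enum_rank (Sub U gU : generator f)); last by rewrite enum_rankK SubK.
by rewrite inE enum_rankK SubK one ?hd // -[U](SubK (generator f) gU) dim_capg.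
Qed.

Lemma max_EKR_attained t : exists Y : {set 'I_m},
  #|Y| = max_EKR f d t /\ {in Y &, forall x y, (gdist x y <= t)%N}.
Proof.
have [|Y hY eY] := @eq_bigmax_cond _ (fun Y : {set generator f} => is_EKR_set d t Y)
  (fun Y => #|Y|).
  apply/card_gt0P; exists set0; rewrite unfold_in.
  by apply/forallP => x; rewrite inE.
exists (enum_rank @: Y); rewrite card_imset /max_EKR -?eY; last exact: enum_rank_inj.
split=> // _ _ /imsetP [x xY ->] /imsetP [y yY ->].
rewrite /gdist !enum_rankK; move: hY; rewrite unfold_in.
by move=> /forallP /(_ x); rewrite xY => /forallP /(_ y); rewrite yY.
Qed.

End GeneratorGraph.

(** * Combination of the ratio bound with the eigenvalue estimates *)

Theorem theorem8p7 (R : realType) (F : finFieldType) (q : nat)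
  (hF : #|F| = q) (hq : (3 <= q)%N)
  (ty : polar_type) (d t : nat) (ht : (0 < t < d)%N)
  (f : form_on F (ambient_dim ty d)) (hf : is_polar_space f)
  (alpha : R)
  (halpha : alpha * ln (1 + q%:R `^ (- polar_eps R ty - 1)) =
            ln (1 + q%:R `^ (- polar_eps R ty))) :
  let eps : R := polar_eps R ty in
  let c : R := (max_EKR f d t)%:R in
  let K : R := (1 + q%:R `^ (- eps)) `^ (alpha / (alpha - 1)) in
  let lmin : R := lambda_min d t q%:R eps in
  (is_smallest_eigenvalue (\sum_(t.+1 <= s < d.+1) adjacency R f d s) lmin /\
   c <= - lmin * K) /\
  (odd t \/ 1 <= eps ->
   c <= gamma_const R q * K *
        q%:R `^ ((t * (d - t - 1))%:R + 'C(t, 2)%:R + t%:R * eps)) /\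
  (~~ odd t -> eps <= 1 ->
   c <= gamma_const R q * K *
        q%:R `^ ((t * (d - t - 1))%:R + 'C(t.+1, 2)%:R)).
Proof.
have /andP [t0 td] := ht.
have td1 : (t <= d.-1)%N by lia.
have dt : (d.-1 - t = d - t - 1)%N by lia.
move=> eps c K lmin.
have d0 : (0 < d)%N := ltn_trans t0 td.
have [E hE reg] := polar_space_regular R d0 hf.
rewrite hF -/eps in hE; pose e : R := q%:R `^ eps.
have q_gt1 : 1 < q%:R :> R by rewrite ltr1n; lia.
have q_gt0 : 0 < q%:R :> R := lt_trans ltr01 q_gt1.
have q_neq0 : q%:R != 0 :> R by rewrite gt_eqF.
have e_gt0 : 0 < e by rewrite powR_gt0.
have eps_ge0 : 0 <= eps by rewrite /eps; case: (ty) => /=; lra.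
have q_ge1 : 1 <= q%:R :> R := ltW q_gt1.
have e_ge1 : 1 <= e by rewrite -(powRr0 q%:R) ler_powR.
pose lam r : R := \sum_(t.+1 <= s < d.+1) (eigen_gen q%:R e d r)`_s.
have lamE r : (r <= d)%N -> lambda d q%:R eps (d - t - 1) r = lam r.
  by move=> rd; apply: lambda_coef.
have lmin_le r : (r <= d)%N -> lmin <= lam r.
  by move=> rd; rewrite -lamE // lambda_min_le.
have [rmin rd lminE] := lambda_min_attained d t q%:R eps; rewrite -/lmin lamE // in lminE.
have gregular (x y : 'I_#|{: generator f}|) s :
    #|[set z | (gdist d x z == 1%N) && (gdist d z y == s)]|%:R =
    intersection_number q%:R e d s (gdist d x y) :> R.
  by rewrite (gdist_regular R d0 reg) hF hE.
have m0 := generators_gt0 reg.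
have [gsym gle geq0] := And3 (@gdist_sym _ _ f d) (@gdist_le _ _ f d) (gdist_eq0 reg).
have lmin_npos : lmin <= 0.
  apply: le_trans (lmin_le 1%N d0) _; rewrite /lam lambda1E //.
  by rewrite oppr_le0 coef_qprod_ge0 // ltW.
have lam0_ge := lambda0_ge q_gt1 e_ge1 td; rewrite -/(lam 0%N) in lam0_ge.
have B_gt0 : 0 < e ^+ d * q%:R ^+ 'C(d, 2) by rewrite mulr_gt0 // exprn_gt0.
have K_ge0 : 0 <= K by rewrite powR_ge0.
have einv : q%:R `^ (- eps) = e^-1 by rewrite powRN.
(* [prod1D_le_powR] is applied with [x0 = q^(-eps)], for which [halpha] is the defining relation of
   [alpha]. *)
have N_le : (eigen_gen q%:R e d 0).[1] <= e ^+ d * q%:R ^+ 'C(d, 2) * K.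
  rewrite /eigen_gen qprod0 mul1r subn0 horner_qprod1 ?gt_eqF // ler_pM2l //.
  rewrite /K einv; apply: prod1D_le_powR => //; first by rewrite invr_gt0.
  rewrite -einv -halpha -/eps; congr (_ * ln (1 + _)).
  by rewrite powRD ?q_neq0 ?implybT // powRN powRN powRr1 // ltW.
have ca : c <= - lmin * K.
  have [Y [cY hY]] := max_EKR_attained f d t.
  have := hoffman_bound q_gt1 e_gt0 m0 gsym geq0 gle gregular hY lmin_le.
  rewrite cY -/c -/(lam 0%N) => hoff.
  have c_ge0 : 0 <= c by rewrite ler0n.
  have nl : 0 <= - lmin by rewrite oppr_ge0.
  have [c0|c0] := eqVneq c 0; first by rewrite c0 mulr_ge0.
  have c_gt0 : 0 < c by rewrite lt0r c0.
  (* After multiplication by [c] and by the lower bound for [lam 0], the claim follows from the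
     ratio bound, as [lam 0 - lmin] is at least [lam 0]. *)
  rewrite -(ler_pM2l B_gt0) -(ler_pM2r c_gt0).
  apply: (@le_trans _ _ ((lam 0%N - lmin) * c ^+ 2)).
    by rewrite -mulrA -expr2 ler_wpM2r ?sqr_ge0 // (le_trans lam0_ge) // lerDl.
  apply: (le_trans hoff); set B := e ^+ d * _ in N_le *.
  rewrite (_ : B * (- lmin * K) * c = - lmin * c * (B * K)); last by ring.
  by rewrite ler_wpM2l ?mulr_ge0.
(* Through (a), the bounds (b) and (c) reduce to upper bounds for [- lmin]. *)
have from_lmin (b : R) : - lmin <= b -> c <= b * K.
  by move=> lb; apply: le_trans ca _; rewrite ler_wpM2r.
have lam0_npos : - lam 0%N <= 0 by rewrite oppr_le0 (le_trans _ lam0_ge) // ltW.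
split; [split; [split|]|split] => //.
- rewrite lminE; exact: (scheme_eigenvalue q_gt1 e_gt0 m0 gsym geq0 gle gregular t rd).
- move=> b hb.
  have [r rd' ->] := scheme_eigenvalueP q_gt1 e_gt0 m0 gsym geq0 gle gregular hb.
  exact: lmin_le.
- move=> hodd; rewrite mulrAC; apply: from_lmin.
  have -> : q%:R `^ ((t * (d - t - 1))%:R + 'C(t, 2)%:R + t%:R * eps) =
      e ^+ t * q%:R ^+ ('C(t, 2) + t * (d.-1 - t)).
    rewrite dt powRD ?q_neq0 ?implybT // powRD ?q_neq0 ?implybT // !powR_mulrn ?(ltW q_gt0) //.
    by rewrite [t%:R * _]mulrC powRrM powR_mulrn ?powR_ge0 // exprD -/e; ring.
  have h := coef_qprod_gamma hq (ltW e_gt0) td1.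
  (* The coefficient estimates cover the rows [r.+1]; in row 0, [- lam 0] is nonpositive. *)
  apply: le_trans h; rewrite lminE; case: rmin rd {lminE} => [_|r rd].
    by apply: le_trans lam0_npos _; rewrite coef_qprod_ge0 // ltW.
  apply: lambda_ge_eprod => //.
  case: hodd => [->|e1]; first by rewrite orbT.
  by have := ler_powR q_ge1 e1; rewrite powRr1 ?(ltW q_gt0) // => ->; rewrite !orbT.
- move=> _ e1; rewrite mulrAC; apply: from_lmin.
  (* As ['C(t.+1, 2) = 'C(t, 2) + t], this is the bound of [coef_qprod_gamma] with parameter [q] in
     place of [e]. *)
  have -> : q%:R `^ ((t * (d - t - 1))%:R + 'C(t.+1, 2)%:R) =
      q%:R ^+ t * q%:R ^+ ('C(t, 2) + t * (d.-1 - t)) :> R.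
    rewrite dt powRD ?q_neq0 ?implybT // !powR_mulrn ?(ltW q_gt0) //.
    by rewrite binS bin1 !exprD; ring.
  have h := coef_qprod_gamma hq (ltW q_gt0) td1.
  apply: le_trans h; rewrite lminE; case: rmin rd {lminE} => [_|r rd].
    by apply: le_trans lam0_npos _; rewrite coef_qprod_ge0 // ltW.
  apply: lambda_ge_qprod => //.
  by have := ler_powR q_ge1 e1; rewrite powRr1 ?(ltW q_gt0).
Qed.
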